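(* Let tolerances $\epsilon_1,\epsilon_2>0$ be given (with $\epsilon_{SA}$ and $\mu$ as in the context, $0<\epsilon_1\le\epsilon_{SA}<\epsilon_2/\mu$), and let streaming data sets $\{\Xi_n\}_{n=1}^N$ with $N<\infty$ be given for the decision-making problem $\inf_{x\in\mathbb R^d}\mathbb E_{\mathbb P}[f(x,\xi)]$. Assume the data streams are slow with respect to the decision-update rate for all $n$, i.e. the length of each time period $n$ is no shorter than $\varphi(1,\bar r)$ (defined in the context). Then the Online Data Assimilation Algorithm (OnDA) is guaranteed to find a sequence of $\epsilon_2$-optimal, $\epsilon_1$-proper data-driven decisions $\{x_n^{\epsilon_2}\}_{n=1}^N$ with associated certificates $\{J_n^{\epsilon_1}(x_n^{\epsilon_2})\}_{n=1}^N$ such that for all $n\in\{1,\dots,N\}$ $$\mathbf P^n\big(\mathbb E_{\mathbb P}[f(x_n^{\epsilon_2},\xi)]\le J_n^{\epsilon_1}(x_n^{\epsilon_2})+\epsilon_1\big)\ge 1-\beta_n .$$ Furthermore, there is a constant $\hat L>0$, depending on the steepness of the function $f$, such that for each $n$ $$\mathbf P^n\big(J_n^{\epsilon_1}(x_n^{\epsilon_2})\le J^\star+\epsilon_1+\epsilon_2+2\hat L\,\epsilon(\beta_n)\big)\ge 1-\beta_n,$$ where $J^\star:=\inf_{x\in\mathbb R^d}\mathbb E_{\mathbb P}[f(x,\xi)]$. In addition, given any tolerance $\epsilon_3>0$, if the data stream is slow with respect to the decision-update rate for all $n\in\{1,\dots,N\}$ with $N\to\infty$, and $\sum_{n=1}^\infty\beta_n<\infty$,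 then there exists a large enough number $n_0(\epsilon_3)>0$ such that the algorithm terminates in finite time with a guaranteed $\epsilon_2$-optimal and $\epsilon_1$-proper data-driven decision $x_{n_0}^{\epsilon_2}$ and a certificate $J_{n_0}^{\epsilon_1}(x_{n_0}^{\epsilon_2})$ such that $$\mathbf P^{n_0}\big(\mathbb E_{\mathbb P}[f(x_{n_0}^{\epsilon_2},\xi)]\le J_{n_0}^{\epsilon_1}(x_{n_0}^{\epsilon_2})+\epsilon_1\big)=1,$$ and, for all the remaining data sets $\{\Xi_n\}_{n=n_0}^\infty$, almost surely $$\sup_{n\ge n_0}J_n^{\epsilon_1}(x_n^{\epsilon_2})\le J^\star+\epsilon_1+\epsilon_2+\epsilon_3 .$$
   Context: **Setting.** $(\Omega,\mathcal F,\mathbb P)$ is a probability space and $\xi:\Omega\to\mathbb R^m$ a random variable with support $\mathcal Z\subseteq\mathbb R^m$; its unknown law is also written $\mathbb P$. $\mathcal M(\mathcal Z)$ is the set of probability distributions on $\mathcal Z$ with finite first moment. $f:\mathbb R^d\times\mathbb R^m\to\mathbb R$ is the cost. $\xi_1,\xi_2,\dots$ are iid samples of $\mathbb P$ revealed sequentially, $\Xi_n=\{\xi_1,\dots,\xi_n\}$, and $\mathbf P^n$ is probability with respect to the $n$ samples. Time period $n$ is the time between the arrivals of $\Xi_n$ and $\Xi_{n+1}$; its length is measured in computational steps (see below). $\|\cdot\|$ is the 1-norm. Confidence levels $1-\beta_n\in(0,1)$ are strictly increasing in $n$, with $\sum_n\beta_n<\infty$ when $N\to\infty$. **Wasserstein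 ball and certificate.** $d_W(\mathbb Q_1,\mathbb Q_2)=\sup\{\int g\,d\mathbb Q_1-\int g\,d\mathbb Q_2\}$ over functions $g$ on $\mathcal Z$ with Lipschitz constant 1. $\hat{\mathbb P}^n=\frac1n\sum_{k=1}^n\delta_{\xi_k}$. Let $c_1,c_2>0$ be constants, depending only on $m,a,b$ (see assumption (i)), with $\mathbf P^n\{d_W(\mathbb P,\hat{\mathbb P}^n)\ge\epsilon\}\le c_1e^{-c_2n\epsilon^{\max\{2,m\}}}$ if $\epsilon\le1$ and $\le c_1e^{-c_2n\epsilon^a}$ if $\epsilon>1$, for all $n\ge1$, $\epsilon>0$, $m\ne2$ (such constants exist by a known measure concentration theorem). Set $\epsilon(\beta_n)=\big(\tfrac{\log(c_1\beta_n^{-1})}{c_2n}\big)^{1/\max\{2,m\}}$ if $n\ge\tfrac{\log(c_1\beta_n^{-1})}{c_2}$, and $\epsilon(\beta_n)=\big(\tfrac{\log(c_1\beta_n^{-1})}{c_2n}\big)^{1/a}$ otherwise. The certificate is $J_n(x)=\sup\{\mathbb E_{\mathbb Q}[f(x,\xi)]:\mathbb Q\in\mathcal M(\mathcal Z),\ d_W(\hat{\mathbb P}^n,\mathbb Q)\le\epsilon(\beta_n)\}$; it equals the value of (P1$_n$): maximize $\frac1n\sum_k f(x,\xi_k-y_k)$ over $y=(y_1,\dots,y_n)$, $y_k\in\mathbb R^m$, subject to $\frac1n\sum_k\|y_k\|\le\epsilon(\beta_n)$, and the value of (P2$_n$): maximize $\frac1n\sum_k h_k(u_k-v_k)$, $h_k(y):=f(x,\xi_k-y)$,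 over $(u,v)\in n\epsilon(\beta_n)\Delta_{2mn}$, where $\Delta_{q}$ is the unit simplex $\{\lambda\in\mathbb R^{q}:\lambda\ge0,\ \sum_i\lambda_i=1\}$. A decision $x$ is *$\epsilon_1$-proper* if it has a value $J_n^{\epsilon_1}(x)$ (the objective of (P1$_n$) at a feasible point $y^{\epsilon_1}$) with $J_n(x)\le J_n^{\epsilon_1}(x)+\epsilon_1$, where $\mathbf P^n(\mathbb E_{\mathbb P}[f(x,\xi)]\le J_n(x))\ge1-\beta_n$. A proper decision $x_n^{\epsilon_2}$ is *$\epsilon_2$-optimal* if $J_n(x_n^{\epsilon_2})-J_n(x)\le\epsilon_2$ for all $x\in\mathbb R^d$. **Standing assumptions.** (i) (light tails) there is $a>1$ with $b:=\mathbb E_{\mathbb P}[\exp(\|\xi\|^a)]<\infty$. (ii) for all $x,\xi$, $h(y)=f(x,\xi-y)$ is differentiable and concave, with finite curvature constant $C_h$ and geometric strong concavity constant $\mu_h>0$ on $\Delta=\Delta_{2mN}$ (in the coordinates $(u,v)$, $y=u-v$). Here $C_h=\sup-\frac2{\gamma^2}(h(y^\star)-h(y)-\langle\nabla h(y),y^\star-y\rangle)$ over $y,s,r\in\Delta$, $\gamma\in[0,1]$, $y^\star=y+\gamma(s-r)$, and $\mu_h=\inf_{y\in\Delta}\inf_{y^\star\in\Delta,\ \langle\nabla h(y),y^\star-y\rangle>0}-\frac{2}{\Gamma(y,y^\star)^2}(h(y^\star)-h(y)-\langle\nabla h(y),y^\star-y\rangle)$, with step-size measure $\Gamma(y,y^\star)=\frac{\langle\nabla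 h(y),y^\star-y\rangle}{\langle\nabla h(y),s(y)-v(y)\rangle}$, where $s(y)$ is a vertex of $\Delta$ maximizing $\langle\nabla h(y),\cdot\rangle$, and $v(y)$ is the vertex realizing $\max_S\min_{v\in S}\langle\nabla h(y),v\rangle$ over vertex sets $S$ such that $y$ is a convex combination of all elements of $S$ with positive weights. (iii) the gradients $\nabla h$ are accessible (their evaluation cost is not counted). (iv) $x\mapsto f(x,\xi)$ is convex for all $\xi$. (v) $J_n$ has a minimizer $x_n^\star$, and the subgradients $g_n^r$ below satisfy $\|g_n^r\|\le L$ for all $r\ge r_n$; $\mu:=\max\{L,1\}$. **Certificate generation (C-Gen), for fixed $x,n$.** Maintains a candidate $y^{(l)}$ and a finite candidate vertex set $I_n^{(l)}$ of points $\tilde y=\tilde u-\tilde v$, $(\tilde u,\tilde v)$ an extreme point of $n\epsilon(\beta_n)\Delta_{2mn}$. Iteration $l\ge1$: (1) Point Search: let $\Omega^{(l)}$ be the set of vectors in $\mathbb R^{mn}$ whose only nonzero entry is $n\epsilon(\beta_n)\,\mathrm{sgn}(\nabla_jh_k(y^{(l-1)}_k))$ at a position $(j,k)$ maximizing $|\nabla_jh_k(y_k^{(l-1)})|$, and $\eta^{(l)}=\frac1n\sum_k\langle\nabla h_k(y^{(l-1)}_k),\tilde y_k-y^{(l-1)}_k\rangle$ for any $\tilde y\in\Omega^{(l)}$; (2) $I_n^{(l)}=I_n^{(l-1)}\cup\Omega^{(l)}$; (3) (CP$_n^{(l)}$): maximize $\frac1n\sum_kh_k(\sum_i\gamma_i\tilde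 y^{[i]}_k)$ over convex weights $\gamma$ on $I_n^{(l)}=\{\tilde y^{[i]}\}$, solved to $\epsilon_1$-optimality by the away-step Frank–Wolfe algorithm (AFWA) with exact line search; $y^{(l)}$ is the solution and $J_n^{(l)}(x)$ its value. Stop when $\eta^{(l)}\le\epsilon_1$; return $J_n^{\epsilon_1}(x)=J_n^{(l)}(x)$, $y^{\epsilon_1}=y^{(l)}$ and $\mathbb Q_n^{\epsilon_1}(x)=\frac1n\sum_k\delta_{\xi_k-y_k^{\epsilon_1}}$. Start: $y^{(0)}=0$, $I_1^{(0)}=\emptyset$. When $\Xi_{n+1}$ arrives, each $\tilde y\in I_n^{(l)}$ is extended to $(\tilde y,0_m)$ and projected onto the extreme points of the new simplex to form $I_{n+1}^{(0)}$. **OnDA.** Start at some $x^{(r)}$, $r=n=1$. In period $n$, started at iteration $r=r_n$: run C-Gen at $x^{(r)}$ to get $\mathbb Q_n^{\epsilon_1}(x^{(r)})$ and set $g_n^r(x)=\frac{d}{dx}\mathbb E_{\mathbb Q_n^{\epsilon_1}(x^{(r)})}[f(x,\xi)]$; update $x^{(r+1)}=x^{(r)}-\alpha^{(r)}g_n^r(x^{(r)})/\max\{\|g_n^r(x^{(r)})\|,1\}$ with a nonnegative step-size rule; at $x^{(r+1)}$ compute the gap $\eta^{(1)}$ by Point Search from $y^{\epsilon_1}$: if $\eta^{(1)}\le\epsilon_{SA}$ reuse $g_n^{r+1}=g_n^r$, otherwise obtain $g_n^{r+1}$ by running C-Gen. After $\bar r$ subgradient iterations ($r_{n+1}=\bar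 r+r_n$) output the best decision $x_n^{\epsilon_2}\in\arg\min_{r_n\le k\le r_{n+1}}J_n(x^{(k)})$. With $M$ sufficiently large, one takes either $\alpha^{(i)}=M/\sqrt{\bar r+1}$ and $\bar r=M^2(\epsilon_2/\mu-\epsilon_{SA})^{-2}$, or $\alpha^{(i)}=M/(i-r_n+1)$ and $\bar r=\min\{r\in\mathbb N: M(3-\frac1{r+1})\le2(\frac{\epsilon_2}\mu-\epsilon_{SA})\ln(r+1)\}$. The next period starts from the best decision found; the algorithm stops after period $n_0$. **Rate.** One computational step is one AFWA iteration or one subgradient iteration. $\varphi(1,\bar r)$ is the worst-case number of steps needed in a period (in the streaming scenario) to reach $x_n^{\epsilon_2}$, bounded by $\bar\phi(1)+\bar r(\log_\kappa(\epsilon_1/t)+1)$, where $\bar\phi(1)=2m\log_{\bar\kappa}\big(\epsilon_1/(J_N(x)-J_N^{sae}(x))\big)$, $J_N^{sae}(x)=\frac1N\sum_{k=1}^Nf(x,\xi_k)$, $\kappa,\bar\kappa\in(0,1)$ are the linear decay rates of AFWA on the problems (CP$_n^{(l)}$), and $t>\epsilon_1$ bounds the initial gaps of the (CP) problems re-solved during the subgradient iterations.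
   Formalization: n_0 is an almost surely valid random index, not a fixed number; for N→∞, ε(β_n)→0 is assumed as well; J* is assumed finite; C-Gen returns the point whose gap passed the stopping test and is rerun at the selected decision to obtain its certificate. *)

(* Defs.v *)
(* MathComp / MathComp-Analysis. *)
From HB Require Import structures.
From mathcomp Require Import all_boot all_order all_algebra.
From mathcomp Require Import all_classical all_reals all_analysis.
Set Implicit Arguments.
Unset Strict Implicit.
Unset Printing Implicit Defensive.
Import Order.TTheory GRing.Theory Num.Theory.
Import numFieldNormedType.Exports.
Local Open Scope classical_set_scope.
Local Open Scope ring_scope.

(** * Probability on R^m *)

Definition norm1 {R : realType} {n : nat} (x : 'rV[R]_n) : R :=
  \sum_(j < n) `|x 0 j|.

(* R^m with its Borel sigma-algebra; convertible to 'rV[R]_m. *)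
Definition borelRV (R : realType) (m : nat) :=
  g_sigma_algebraType (@open 'rV[R]_m).

(* A need not be measurable (a decision picked by the algorithm need not depend
   measurably on the samples): these are bounds on its inner, resp. outer,
   probability, and the usual ones when A is measurable. *)
Definition prob_ge {R : realType} {dO : measure_display}
    {Omega : measurableType dO} (Pr : probability Omega R)
    (A : set Omega) (p : R) : Prop :=
  exists B : set Omega, [/\ measurable B, B `<=` A & (p%:E <= Pr B)%E].

Definition prob_le {R : realType} {dO : measure_display}
    {Omega : measurableType dO} (Pr : probability Omega R)
    (A : set Omega) (p : R) : Prop :=
  exists B : set Omega, [/\ measurable B, A `<=` B & (Pr B <= p%:E)%E].

(* Independence of every finite subfamily follows by taking some A i = setT. *)
Definition mutually_independent {R : realType} {dO dT : measure_display}
    {Omega : measurableType dO} {T : measurableType dT}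
    (Pr : probability Omega R) (X : nat -> {RV Pr >-> T}) : Prop :=
  forall (n : nat) (A : nat -> set T), (forall i, measurable (A i)) ->
    Pr (\bigcap_(i < n) (X i @^-1` A i)) =
    (\prod_(i < n) Pr (X i @^-1` A i))%E.

Section Ambiguity.
Context {R : realType} {m : nat}.
Implicit Types (Z : set 'rV[R]_m) (z : nat -> 'rV[R]_m).

Definition is_support (P : probability (borelRV R m) R) Z : Prop :=
  [/\ closed Z, P Z = 1%E &
      forall C : set 'rV[R]_m, closed C -> P C = 1%E -> Z `<=` C].

Definition finite_moment_on Z : set (probability (borelRV R m) R) :=
  [set Q : probability (borelRV R m) R | Q Z = 1%E /\ (\int[Q]_q (norm1 q)%:E < +oo)%E].

Definition wasserstein Z (mu nu : {measure set (borelRV R m) -> \bar R})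
    : \bar R :=
  ereal_sup [set ((\int[mu]_(q in Z) (g q)%:E) -
                  (\int[nu]_(q in Z) (g q)%:E))%E |
    g in [set g : borelRV R m -> R |
      forall q q' : 'rV[R]_m, Z q -> Z q' -> `|g q - g q'| <= norm1 (q - q')]].

(* The n-th data set is z 0, ..., z (n - 1). *)
Definition empirical (n : nat) z : {measure set (borelRV R m) -> \bar R} :=
  mscale (n%:R^-1)%:nng (msum (fun k => @dirac _ (borelRV R m) (z k) R) n).

Definition conc_bound (a c1 c2 : R) (n : nat) (e : R) : R :=
  if e <= 1 then c1 * expR (- (c2 * n%:R * e ^+ maxn 2 m))
  else c1 * expR (- (c2 * n%:R * e `^ a)).

Definition wass_radius (a c1 c2 : R) (beta : nat -> R) (n : nat) : R :=
  let l := ln (c1 / beta n) in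
  if l / c2 <= n%:R then (l / (c2 * n%:R)) `^ ((maxn 2 m)%:R^-1)
  else (l / (c2 * n%:R)) `^ a^-1.

End Ambiguity.

Arguments conc_bound {R} m.
Arguments wass_radius {R} m.

(** * Certificates *)

Section Certificate.
Context {R : realType} {d m : nat}.
Variable f : 'rV[R]_d -> 'rV[R]_m -> R.

Definition expected_cost (P : probability (borelRV R m) R) (x : 'rV[R]_d)
    : \bar R :=
  (\int[P]_q (f x q)%:E)%E.

Definition optimal_cost (P : probability (borelRV R m) R) : \bar R :=
  ereal_inf (range (expected_cost P)).

Definition certificate (Z : set 'rV[R]_m) (rho : R) (n : nat)
    (z : nat -> 'rV[R]_m) (x : 'rV[R]_d) : \bar R :=
  ereal_sup [set expected_cost Q x | Q in [set Q : probability (borelRV R m) R |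
    finite_moment_on Z Q /\ (wasserstein Z (empirical n z) Q <= rho%:E)%E]].

(* Problem (P1): row k y is the displacement y_k of the k-th sample. *)
Definition objective (n : nat) (z : nat -> 'rV[R]_m) (x : 'rV[R]_d)
    (y : 'M[R]_(n, m)) : R :=
  n%:R^-1 * \sum_(k < n) f x (z k - row k y).

Definition feasible (n : nat) (rho : R) : set 'M[R]_(n, m) :=
  [set y | n%:R^-1 * \sum_(k < n) norm1 (row k y) <= rho].

Definition P1_value (n : nat) (rho : R) (z : nat -> 'rV[R]_m) (x : 'rV[R]_d)
    : \bar R :=
  ereal_sup [set (objective z x y)%:E | y in @feasible n rho].

Definition hfun (x : 'rV[R]_d) (q y : 'rV[R]_m) : R := f x (q - y).

Definition hpartial (x : 'rV[R]_d) (q y : 'rV[R]_m) (j : 'I_m) : R :=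
  'D_(delta_mx 0 j) (hfun x q) y.

(* The pairing of e with the gradient of the objective of (P1) at y. *)
Definition slope (n : nat) (z : nat -> 'rV[R]_m) (x : 'rV[R]_d)
    (y e : 'M[R]_(n, m)) : R :=
  n%:R^-1 * \sum_(k < n) \sum_(j < m) hpartial x (z k) (row k y) j * e k j.

(** * The simplex and the curvature constants *)

(* The coordinates of R^(2mn): (false, k, j) is the coordinate (u_k)_j and
   (true, k, j) is (v_k)_j; each also names an extreme point of the simplex. *)
Definition vtx (n : nat) : finType := (bool * 'I_n * 'I_m)%type.

Definition weights (n : nat) := {ffun vtx n -> R}.

(* u - v for the extreme point (u, v) = c * e_i of the scaled simplex. *)
Definition vertex (n : nat) (c : R) (i : vtx n) : 'M[R]_(n, m) :=
  ((-1) ^+ i.1.1 * c) *: delta_mx i.1.2 i.2.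

(* u - v for (u, v) = c * w. *)
Definition displacement (n : nat) (c : R) (w : weights n) : 'M[R]_(n, m) :=
  \sum_(i : vtx n) w i *: vertex c i.

Definition convex_weights (n : nat) (I : {set vtx n}) : set (weights n) :=
  [set w | [/\ forall i, 0 <= w i, forall i, i \notin I -> w i = 0 &
              \sum_i w i = 1]].

(* The partial derivative along e_i of w |-> objective (displacement c w). *)
Definition score (n : nat) (z : nat -> 'rV[R]_m) (x : 'rV[R]_d) (c : R)
    (w : weights n) (i : vtx n) : R :=
  slope z x (displacement c w) (vertex c i).

Definition pairing (n : nat) (q : vtx n -> R) (e : weights n) : R :=
  \sum_i e i * q i.

(* On the unit simplex of R^(2mn), in the coordinates (u, v) with y = u - v in
   R^(mn), the function h is the objective of (P1) for arbitrary sample points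
   z 0, ..., z (n - 1). *)
Definition bregman (n : nat) (z : nat -> 'rV[R]_m) (x : 'rV[R]_d)
    (w w' : weights n) : R :=
  objective z x (displacement 1 w') - objective z x (displacement 1 w)
  - pairing (score z x 1 w) (w' - w).

Definition curvature (n : nat) (z : nat -> 'rV[R]_m) (x : 'rV[R]_d) : \bar R :=
  ereal_sup [set C | exists (y s r : weights n) (t : R),
    [/\ convex_weights [set: vtx n]%SET y, convex_weights [set: vtx n]%SET s,
        convex_weights [set: vtx n]%SET r, 0 <= t <= 1 &
        C = (- (2 / t ^+ 2) *
             bregman z x y [ffun i => y i + t * (s i - r i)])%:E]].

Definition toward_vertex (n : nat) (q : vtx n -> R) (s : vtx n) : Prop :=
  forall i, q i <= q s.

(* y is a convex combination of all the vertices in S, with positive weights. *)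
Definition represents (n : nat) (S : {set vtx n}) (y : weights n) : Prop :=
  exists lam : vtx n -> R,
    [/\ forall i, i \in S -> 0 < lam i, \sum_(i in S) lam i = 1 &
        y = [ffun j => \sum_(i in S) lam i * (j == i)%:R]].

Definition away_vertex (n : nat) (q : vtx n -> R) (y : weights n) (v : vtx n)
    : Prop :=
  (exists S, [/\ represents S y, v \in S & forall i, i \in S -> q v <= q i]) /\
  (forall S, represents S y -> exists2 i, i \in S & q i <= q v).

Definition geom_concavity (n : nat) (z : nat -> 'rV[R]_m) (x : 'rV[R]_d)
    : \bar R :=
  ereal_inf [set C | exists (y y' : weights n) (s v : vtx n),
    let q := score z x 1 y in
    let Gamma := pairing q (y' - y) / (q s - q v) in
    [/\ convex_weights [set: vtx n]%SET y, convex_weights [set: vtx n]%SET y',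
        0 < pairing q (y' - y), toward_vertex q s /\ away_vertex q y v &
        C = (- (2 / Gamma ^+ 2) * bregman z x y y')%:E]].

Definition curvature_condition (n : nat) : Prop :=
  forall (z : nat -> 'rV[R]_m) (x : 'rV[R]_d),
    (curvature n z x < +oo)%E /\ (0 < geom_concavity n z x)%E.

End Certificate.

Arguments vtx : clear implicits.
Arguments weights : clear implicits.

(** * The algorithm *)

Inductive phase (R : realType) (m n : nat) : Type :=
| Check                     (* a new iterate: can the current y be reused? *)
| Search of bool            (* C-Gen, about to run Point Search *)
| Solve of bool & weights R m n (* C-Gen, AFWA at some weights on (CP) *)
| Update                    (* y is accepted for x: subgradient iteration *)
| Stop.                     (* the decision of the period has been output *)
(* The flag is true once the best decision has been selected, when C-Gen
   computes its certificate. *)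
Arguments Check {R m n}.
Arguments Search {R m n}.
Arguments Solve {R m n}.
Arguments Update {R m n}.
Arguments Stop {R m n}.

Record state (R : realType) (d m n : nat) := State {
  st_it : nat;                     (* r - r_n *)
  st_x : 'rV[R]_d;
  st_y : 'M[R]_(n, m);
  st_I : {set vtx m n};
  st_hist : seq ('rV[R]_d * 'M[R]_(n, m)); (* the pairs (x^(r), y^(r)) so far *)
  st_phase : phase R m n }.

Section Period.
Context {R : realType} {d m : nat}.
Variables (f : 'rV[R]_d -> 'rV[R]_m -> R)
          (sg : 'rV[R]_d -> 'rV[R]_m -> 'rV[R]_d)
          (Z : set 'rV[R]_m) (eps1 epsSA : R).
Variables (n : nat) (z : nat -> 'rV[R]_m) (rho : R).
Variables (alpha : nat -> R) (rbar : nat).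

Let J : 'rV[R]_d -> \bar R := certificate f Z rho n z.
Let c : R := n%:R * rho.
Let st := state R d m n.

(* If all the partial derivatives at y vanish, any vertex belongs to the set;
   the gap is then 0. *)
Definition search_set (x : 'rV[R]_d) (y : 'M[R]_(n, m)) : {set vtx m n} :=
  let g (k : 'I_n) (j : 'I_m) := hpartial f x (z k) (row k y) j in
  [set i : vtx m n |
    [forall k : 'I_n, forall j : 'I_m, `|g k j| <= `|g i.1.2 i.2|] &&
    (g i.1.2 i.2 == (-1) ^+ i.1.1 * `|g i.1.2 i.2|)].

Definition gap (x : 'rV[R]_d) (y : 'M[R]_(n, m)) (i : vtx m n) : R :=
  slope f z x y (vertex c i - y).

(* One iteration of AFWA (exact line search) on (CP) over the candidates I. *)
Definition afw_step (x : 'rV[R]_d) (I : {set vtx m n}) (w w' : weights R m n)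
    : Prop :=
  let q := score f z x c w in
  let avg := pairing q w in
  exists s v : vtx m n,
    [/\ s \in I /\ (forall i, i \in I -> q i <= q s),
        0 < w v /\ (forall i, 0 < w i -> q v <= q i) &
        let toward := avg - q v <= q s - avg in
        let dir i := if toward then (i == s)%:R - w i else w i - (i == v)%:R in
        let tmax := if toward then 1 else w v / (1 - w v) in
        let move t : weights R m n := [ffun i => w i + t * dir i] in
        exists t, [/\ 0 <= t <= tmax,
          forall t', 0 <= t' <= tmax ->
            objective f z x (displacement c (move t')) <=
            objective f z x (displacement c (move t)) &
          w' = move t]].

(* AFWA stops when its Frank-Wolfe gap on (CP) is at most eps1. *)
Definition afw_done (x : 'rV[R]_d) (I : {set vtx m n}) (w : weights R m n)
    : Prop :=
  let q := score f z x c w in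
  forall i, i \in I -> q i - pairing q w <= eps1.

(* The value at x of the subgradient function attached to the distribution
   supported by the points z k - y_k. *)
Definition subgradient (x : 'rV[R]_d) (y : 'M[R]_(n, m)) : 'rV[R]_d :=
  n%:R^-1 *: \sum_(k < n) sg x (z k - row k y).

(* [step s k s']: a move from s to s' that takes k computational steps; a
   computational step is one AFWA iteration or one subgradient iteration. *)
Inductive step : st -> nat -> st -> Prop :=
| step_reuse it x y I h i :
    i \in search_set x y -> gap x y i <= epsSA ->
    step (State it x y I h Check) 0 (State it x y I h Update)
| step_regenerate it x y I h i :
    i \in search_set x y -> epsSA < gap x y i ->
    step (State it x y I h Check) 0 (State it x y I h (Search false))
(* The test certifies the point y at which the gap was computed, and y is the
   point returned: AFWA started from y on the enlarged (CP) would stop at y. *)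
| step_accept it x y I h b i :
    i \in search_set x y -> gap x y i <= eps1 ->
    step (State it x y I h (Search b)) 0
         (State it x y I h (if b then Stop else Update))
| step_enlarge it x y I h b i w :
    i \in search_set x y -> eps1 < gap x y i ->
    convex_weights (I :|: search_set x y) w ->
    step (State it x y I h (Search b)) 0
         (State it x y (I :|: search_set x y) h (Solve b w))
| step_afw it x y I h b w w' :
    ~ afw_done x I w -> afw_step x I w w' ->
    step (State it x y I h (Solve b w)) 1 (State it x y I h (Solve b w'))
| step_solved it x y I h b w :
    afw_done x I w ->
    step (State it x y I h (Solve b w)) 0
         (State it x (displacement c w) I h (Search b))
| step_update it x y I h :
    (it < rbar)%N ->
    let g := subgradient x y in
    step (State it x y I h Update) 1
         (State it.+1 (x - (alpha it / Num.max (norm1 g) 1) *: g) y I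
            (rcons h (x, y)) Check)
| step_select x y I h p :
    p \in rcons h (x, y) ->
    (forall p', p' \in rcons h (x, y) -> (J p.1 <= J p'.1)%E) ->
    step (State rbar x y I h Update) 0
         (State rbar p.1 p.2 I (rcons h (x, y)) (Search true)).

Inductive reach (s : st) : nat -> st -> Prop :=
| reach_refl : reach s 0 s
| reach_step k s' k' s'' : reach s k s' -> step s' k' s'' ->
    reach s (k + k')%N s''.

Definition period_init (x : 'rV[R]_d) (I : {set vtx m n}) : st :=
  State 0 x 0 I [::] (Search false).

(* The worst-case number of computational steps of the period. *)
Definition phi (x : 'rV[R]_d) (I : {set vtx m n}) : \bar R :=
  ereal_sup [set (k%:R)%:E | k in
    [set k | exists s, reach (period_init x I) k s]].

(* State of the algorithm when the next sample arrives, after T steps: no move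
   fits in the time that is left. *)
Definition period_end (T : nat) (x : 'rV[R]_d) (I : {set vtx m n}) (s : st)
    : Prop :=
  exists k, [/\ reach (period_init x I) k s, (k <= T)%N &
    forall k' s', step s k' s' -> (T < k + k')%N].

Definition best_found (s : st) (x : 'rV[R]_d) : Prop :=
  if st_phase s is Stop then x = st_x s else
  let xs := st_x s :: [seq p.1 | p <- st_hist s] in
  x \in xs /\ forall x', x' \in xs -> (J x <= J x')%E.

End Period.

Section Online.
Context {R : realType} {d m : nat}.
Variables (f : 'rV[R]_d -> 'rV[R]_m -> R)
          (sg : 'rV[R]_d -> 'rV[R]_m -> 'rV[R]_d)
          (Z : set 'rV[R]_m) (rho : nat -> R) (eps1 epsSA : R).

(* Step sizes alpha^(r_n + i) and number rbar of subgradient iterations in a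
   period, for a tolerance tol = eps2 / mu - epsSA; in the first rule rbar is
   M^2 / tol^2 rounded up. *)
Definition least_nat (P : nat -> Prop) (r : nat) : Prop :=
  P r /\ forall r', P r' -> (r <= r')%N.

Definition constant_rule (tol M : R) (alpha : nat -> R) (rbar : nat) : Prop :=
  (forall i, alpha i = M / Num.sqrt rbar.+1%:R) /\
  least_nat (fun r => M ^+ 2 / tol ^+ 2 <= r%:R) rbar.

Definition harmonic_rule (tol M : R) (alpha : nat -> R) (rbar : nat) : Prop :=
  (forall i, alpha i = M / i.+1%:R) /\
  least_nat (fun r => M * (3 - r.+1%:R^-1) <= 2 * tol * ln r.+1%:R) rbar.

Record run := Run {
  run_M : nat -> R;
  run_alpha : nat -> nat -> R;
  run_rbar : nat -> nat;
  run_start : nat -> 'rV[R]_d;             (* x^(r_n) *)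
  run_end : forall n : nat, state R d m n  (* state at the end of period n *) }.

(* Extending a candidate (u, v) by 0 and projecting it on the extreme points of
   the next (rescaled) simplex keeps the nonzero coordinate. *)
Definition extend_set (n : nat) (I : {set vtx m n}) : {set vtx m n.+1} :=
  [set (i.1.1, widen_ord (leqnSn n) i.1.2, i.2) | i in I]%SET.

(* At n = 1 this is the empty set, as there is no vertex in vtx m 0. *)
Definition start_set (o : run) (n : nat) : {set vtx m n} :=
  if n is n'.+1 then extend_set (st_I (run_end o n')) else finset.set0.

(* [T n] is the length of period n, counted in computational steps. *)
Definition OnDA (tol : R) (N : nat) (T : nat -> nat) (z : nat -> 'rV[R]_m)
    (o : run) : Prop :=
  forall n, (0 < n <= N)%N ->
    [/\ constant_rule tol (run_M o n) (run_alpha o n) (run_rbar o n) \/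
        harmonic_rule tol (run_M o n) (run_alpha o n) (run_rbar o n),
        period_end f sg Z eps1 epsSA z (rho n) (run_alpha o n) (run_rbar o n)
          (T n) (run_start o n) (start_set o n) (run_end o n) &
        (n < N)%N ->
        best_found f Z z (rho n) (run_end o n) (run_start o n.+1)].

Definition slow_stream (N : nat) (T : nat -> nat) (z : nat -> 'rV[R]_m)
    (o : run) : Prop :=
  forall n, (0 < n <= N)%N ->
    (phi f sg Z eps1 epsSA z (rho n) (run_alpha o n) (run_rbar o n)
       (run_start o n) (start_set o n) <= ((T n)%:R)%:E)%E.

Definition bounded_subgradients (L : R) (N : nat) (z : nat -> 'rV[R]_m)
    (o : run) : Prop :=
  forall n, (0 < n <= N)%N ->
    forall p, p \in st_hist (run_end o n) -> norm1 (subgradient sg z p.1 p.2) <= L.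

Definition large_M (xstar : nat -> (nat -> 'rV[R]_m) -> 'rV[R]_d) (N : nat)
    (z : nat -> 'rV[R]_m) (o : run) : Prop :=
  forall n, (0 < n <= N)%N -> norm1 (run_start o n - xstar n z) <= run_M o n.

(** * Guarantees *)

Definition decision (o : run) (n : nat) : 'rV[R]_d := st_x (run_end o n).

Definition cert_value (z : nat -> 'rV[R]_m) (o : run) (n : nat) : R :=
  objective f z (decision o n) (st_y (run_end o n)).

Definition completed (o : run) (n : nat) : Prop :=
  st_phase (run_end o n) = Stop.

Definition eps_optimal (eps : R) (n : nat) (z : nat -> 'rV[R]_m)
    (x : 'rV[R]_d) : Prop :=
  forall x', (certificate f Z (rho n) n z x - certificate f Z (rho n) n z x'
              <= eps%:E)%E.

Definition eps_certified (n : nat) (z : nat -> 'rV[R]_m) (x : 'rV[R]_d)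
    (y : 'M[R]_(n, m)) : Prop :=
  feasible (rho n) y /\
  (certificate f Z (rho n) n z x <= (objective f z x y + eps1)%:E)%E.

End Online.

Arguments run : clear implicits.

(* Main.v *)
Require Import Defs.
From HB Require Import structures.
From mathcomp Require Import all_boot all_order all_algebra.
From mathcomp Require Import all_classical all_reals all_analysis.
From mathcomp Require Import measurable_realfun ring lra.
Set Implicit Arguments.
Unset Strict Implicit.
Unset Printing Implicit Defensive.
Import Order.TTheory GRing.Theory Num.Theory.
Import numFieldNormedType.Exports.
Local Open Scope classical_set_scope.
Local Open Scope ring_scope.

(* A slow stream leaves no room for a further move at the end of a period, and
   every reachable state other than Stop has one (an exact line search has a
   maximizer), so every period is completed.

   By concavity, J(x) exceeds the objective at y by at most the Point Search
   gap at y, so the averaged subgradient at y is an epsSA-subgradient of J. The square of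
   the Euclidean distance to a minimizer of J is then a potential that, were no
   iterate eps2-optimal, the step-size rule would make negative.

   The unknown law P lies in the Wasserstein ball outside an event of
   probability beta_n; there the certificate dominates the expected cost. For
   the converse bound, the concave f(x, .) need not be Lipschitz, but it is a
   decreasing limit of K-Lipschitz sup-convolutions, so f(x, .) has a Lipschitz
   majorant whose P-mean is at most J* + eps1 for a suitable x; Lhat is its
   constant. The asymptotic claim follows by Borel-Cantelli. *)

(** * Concavity and the problem (P1) *)

(** The derivative along [y' - y] is the right limit of difference quotients, each at least
    [h y' - h y] by concavity on the segment; differentiability expands it into partial
    derivatives. *)
Lemma concave_le_tangent (R : realType) (m : nat) (h : 'rV[R]_m -> R)
    (y y' : 'rV[R]_m) :
  differentiable h y -> convex_function [set: 'rV[R]_m] (- h) ->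
  h y' <= h y + \sum_(j < m) 'D_(delta_mx 0 j) h y * (y' - y) 0 j.
Proof.
move=> hd hc.
have -> : \sum_(j < m) 'D_(delta_mx 0 j) h y * (y' - y) 0 j = 'D_(y' - y) h y.
  rewrite [RHS]deriveE// {2}(row_sum_delta (y' - y)) linear_sum/=.
  by apply: eq_bigr => j _; rewrite deriveE// linearZ/= mulrC.
rewrite -lerBlDl.
have hD : derivable h y (y' - y) by exact: diff_derivable.
have hl := cvg_dnbhs_at_right hD; rewrite /derive -(cvg_lim _ hl)//.
apply: limr_ge; first by apply/cvg_ex; eexists; exact: hl.
near=> t.
have t0 : 0 < t by near: t; exact: nbhs_right_gt.
have t1 : t <= 1 by near: t; exact: nbhs_right_le.
have hle : t * h y' + (1 - t) * h y <= h (t *: y' + (1 - t) *: y).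
  have := hc (Itv01 (ltW t0) t1) y' y; rewrite !inE => /(_ Logic.I Logic.I) hle.
  by rewrite -lerN2 opprD -!mulrN; exact: hle.
rewrite (_ : t *: y' + _ = t *: (y' - y) + y) in hle; last first.
  by rewrite scalerBl scale1r scalerBr addrA addrAC.
rewrite /= -(ler_pM2l t0) [leRHS]mulrA divff ?gt_eqF// mul1r lerBrDr.
by rewrite (le_trans _ hle)// mulrBr mulrBl mul1r addrA addrAC.
Unshelve. all: by end_near.
Qed.

Lemma affine_continuous (R : realType) (m : nat) (A B : 'rV[R]_m) :
  continuous (fun t : R => A + t *: B).
Proof.
by move=> t; apply: cvgD; [exact: cvg_cst|apply: cvgZr_tmp; exact: cvg_id].
Qed.

Section Objective.
Context {R : realType} {d m : nat} (f : 'rV[R]_d -> 'rV[R]_m -> R).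
Context (n : nat) (z : nat -> 'rV[R]_m) (x : 'rV[R]_d).
Implicit Types (y e : 'M[R]_(n, m)).

Lemma slopeB y e e' : slope f z x y (e - e') = slope f z x y e - slope f z x y
  e'.
Proof.
rewrite /slope -mulrBr -sumrB; congr (_ * _); apply: eq_bigr => k _.
by rewrite -sumrB; apply: eq_bigr => j _; rewrite !mxE mulrBr.
Qed.

Lemma slope_vertex y c i :
  slope f z x y (vertex c i) =
  n%:R^-1 * (hpartial f x (z i.1.2) (row i.1.2 y) i.2 * ((-1) ^+ i.1.1 * c)).
Proof.
rewrite /slope /vertex; congr (_ * _).
rewrite (bigD1 i.1.2)//= [X in _ + X]big1 ?addr0; last first.
  move=> k ki; rewrite big1// => j _; rewrite !mxE (negPf ki)/= !mulr0//.
rewrite (bigD1 i.2)//= [X in _ + X]big1 ?addr0; last first.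
  by move=> j ji; rewrite !mxE (negPf ji) andbF !mulr0.
by rewrite !mxE !eqxx !mulr1.
Qed.

Lemma search_set_neq0 y : (0 < n)%N -> (0 < m)%N ->
  exists i, i \in search_set f z x y.
Proof.
move=> n0 m0.
pose g (p : 'I_n * 'I_m) := `|hpartial f x (z p.1) (row p.1 y) p.2|.
pose p0 := (Ordinal n0, Ordinal m0).
have [p _ pmax] := @arg_maxP _ R _ p0 xpredT g isT.
exists (hpartial f x (z p.1) (row p.1 y) p.2 < 0, p.1, p.2).
rewrite inE /=; apply/andP; split.
  by apply/forallP => k; apply/forallP => j; exact: (pmax (k, j)).
have [h0|h0] := ltP; first by rewrite expr1 mulN1r ltr0_norm// opprK.
by rewrite expr0 mul1r ger0_norm.
Qed.

(** Duality of the 1-norm and the max-norm: on a 1-norm ball of radius [n * rho], a linear form is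
    largest at the signed vertex of its largest coefficient. Both sides are compared with
    [|g| * rho]. *)
Lemma slope_feasible_le rho y y' i : (0 < n)%N ->
  i \in search_set f z x y -> feasible rho y' ->
  slope f z x y y' <= slope f z x y (vertex (n%:R * rho) i).
Proof.
move=> n0; rewrite inE => /andP[/forallP gmax /eqP gi] y'f.
set g := hpartial _ _ _ _ _ in gi.
have gmax' (k : 'I_n) (j : 'I_m) : `|hpartial f x (z k) (row k y) j| <= `|g|.
  by move: (gmax k) => /forallP/(_ j).
have n0' : 0 < n%:R :> R by rewrite ltr0n.
have -> : slope f z x y (vertex (n%:R * rho) i) = `|g| * rho.
  rewrite slope_vertex -/g [in LHS]gi mulrA [_ * `|g|]mulrC -mulrA -mulrA.
  rewrite [(-1) ^+ _ * ((-1) ^+ _ * _)]mulrA -expr2 sqrr_sign mul1r.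
  by rewrite mulrCA mulKf// gt_eqF.
apply: (@le_trans _ _ (`|g| * (n%:R^-1 * \sum_(k < n) norm1 (row k y'))));
  last first.
  by rewrite ler_wpM2l.
rewrite mulrCA /slope ler_pM2l ?invr_gt0// mulr_sumr ler_sum// => k _.
rewrite mulr_sumr ler_sum// => j _; rewrite mxE.
by rewrite (le_trans (ler_norm _))// normrM ler_wpM2r.
Qed.

Hypothesis f_diff : forall x (q y : 'rV[R]_m), differentiable (hfun f x q) y.
Hypothesis f_concave :
  forall x q, convex_function [set: 'rV[R]_m] (- hfun f x q).

Lemma objective_le_slope y y' :
  objective f z x y' <= objective f z x y + slope f z x y (y' - y).
Proof.
rewrite /objective /slope -mulrDr -big_split/=.
rewrite ler_wpM2l ?invr_ge0 ?ler0n// ler_sum// => k _.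
have := concave_le_tangent (row k y') (f_diff x (z k) (row k y)) (f_concave x
  (z k)).
move=> /le_trans; apply; rewrite lerD2l.
by apply: ler_sum => j _; rewrite !mxE.
Qed.

(** The Frank-Wolfe gap bounds the suboptimality of [y] in (P1): tangent bound, then maximality of
    the vertex. *)
Lemma objective_le_gap rho y y' i : (0 < n)%N ->
  i \in search_set f z x y -> feasible rho y' ->
  objective f z x y' <= objective f z x y + gap f z rho x y i.
Proof.
move=> n0 iy y'f; rewrite (le_trans (objective_le_slope y y'))// lerD2l.
by rewrite /gap !slopeB lerD2r slope_feasible_le.
Qed.

(** Needed for the exact line search, which moves along such a line. *)
Lemma objective_line_continuous (A B : 'M[R]_(n, m)) :
  continuous (fun t : R => objective f z x (A + t *: B)).
Proof.
move=> t; rewrite /objective.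
apply: (@cvgM _ _ _ _ (fun=> n%:R^-1)); first exact: cvg_cst.
apply: (@cvg_big _ _ +%R 0); first exact: add_continuous.
move=> k _.
have hc : {for row k A + t *: row k B, continuous (hfun f x (z k))}.
  by apply: differentiable_continuous; exact: f_diff.
under eq_fun do rewrite linearD linearZ/=.
rewrite linearD linearZ/=.
apply: (@continuous_comp _ _ _ (fun t : R => row k A + t *: row k B)
  (hfun f x (z k)) t); last exact: hc.
exact: affine_continuous.
Qed.

End Objective.

(** * The 1-norm and feasibility of displacements *)

Section Displacement.
Context {R : realType} {m n : nat}.

Lemma norm1D {p} (a b : 'rV[R]_p) : norm1 (a + b) <= norm1 a + norm1 b.
Proof.
by rewrite /norm1 -big_split/=; apply: ler_sum => j _; rewrite mxE ler_normD.
Qed.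

Lemma norm1Z {p} (t : R) (a : 'rV[R]_p) : norm1 (t *: a) = `|t| * norm1 a.
Proof. by rewrite /norm1 mulr_sumr; apply: eq_bigr => j _;
  rewrite mxE normrM. Qed.

Lemma norm1_ge0 {p} (a : 'rV[R]_p) : 0 <= norm1 a.
Proof. by rewrite sumr_ge0. Qed.

Lemma norm1N {p} (a : 'rV[R]_p) : norm1 (- a) = norm1 a.
Proof. by rewrite -scaleN1r norm1Z normrN1 mul1r. Qed.

Lemma norm1_sub {p} (a b c : 'rV[R]_p) : norm1 (a - c) <=
  norm1 (a - b) + norm1 (b - c).
Proof. by rewrite -[a - c](subrKA b) norm1D. Qed.

Lemma sum_norm1_vertex (c : R) (i : vtx m n) : \sum_k norm1 (row k (vertex c
  i)) = `|c|.
Proof.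
rewrite (bigD1 i.1.2)//= [X in _ + X]big1 ?addr0; last first.
  move=> k ki; rewrite /norm1 big1// => j _.
  by rewrite !mxE (negPf ki)/= mulr0 normr0.
rewrite /norm1 (bigD1 i.2)//= [X in _ + X]big1 ?addr0; last first.
  by move=> j ji; rewrite !mxE (negPf ji) andbF mulr0 normr0.
by rewrite !mxE !eqxx mulr1 normrM normrX normrN1 expr1n mul1r.
Qed.

(** A displacement is a convex combination of vertices of total 1-norm [n * rho]; the triangle
    inequality concludes. *)
Lemma feasible_displacement (rho : R) (I : {set vtx m n}) (w : weights R m n) :
  (0 < n)%N -> 0 <= rho -> convex_weights I w ->
  feasible rho (displacement (n%:R * rho) w).
Proof.
move=> n0 rho0 [w0 _ w1]; rewrite /feasible /=.
have n0' : 0 < n%:R :> R by rewrite ltr0n.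
rewrite ler_pdivrMl//.
have : 0 <= n%:R * rho by rewrite mulr_ge0// ltW.
move: (n%:R * rho) => c c0.
apply: (@le_trans _ _ (\sum_(k < n) \sum_i w i * norm1 (row k (vertex c i)))).
  apply: ler_sum => k _.
  rewrite /displacement linear_sum/=.
  elim/big_ind2 : _ => [|a b a' b' ha hb|i _].
  - by rewrite /norm1 big1// => j _; rewrite mxE normr0.
  - by rewrite (le_trans (norm1D _ _))// lerD.
  - by rewrite linearZ/= norm1Z ger0_norm.
rewrite exchange_big/=; under eq_bigr do rewrite -mulr_sumr sum_norm1_vertex.
by rewrite -mulr_suml w1 mul1r ger0_norm.
Qed.

Lemma displacement_move (c t : R) (w : weights R m n) (g : vtx m n -> R) :
  displacement c [ffun i => w i + t * g i] =
  displacement c w + t *: \sum_i g i *: vertex c i.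
Proof.
rewrite /displacement scaler_sumr -big_split/=; apply: eq_bigr => i _.
by rewrite ffunE scalerDl scalerA.
Qed.

Lemma feasible0 (rho : R) : 0 <= rho -> feasible rho (0 : 'M[R]_(n, m)).
Proof.
move=> rho0; rewrite /feasible/= big1 ?mulr0// => k _.
by rewrite /norm1 big1// => j _; rewrite !mxE normr0.
Qed.

End Displacement.

(** * Step-size rules *)

Section StepSizes.
Context {R : realType}.
Implicit Types (alpha : nat -> R) (M tol : R).

(** Induction, with [ln (1 + x) <= x] at [x = r.+1%:R^-1]. *)
Lemma ln_le_harmonic r : ln r.+1%:R <= \sum_(i < r) i.+1%:R^-1 :> R.
Proof.
elim: r => [|r ih]; first by rewrite big_ord0 ln1.
have r0 : 0 < r.+1%:R :> R by rewrite ltr0n.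
rewrite big_ord_recr/=.
rewrite (_ : r.+2%:R = r.+1%:R * (1 + r.+1%:R^-1)); last first.
  by rewrite mulrDr mulr1 divff ?gt_eqF// natr1.
rewrite lnM ?posrE ?addr_gt0 ?invr_gt0// lerD//.
by rewrite le_ln1Dx// (lt_trans (ltrN10 _))// invr_gt0.
Qed.

(** Comparison with a telescoping sum: [1/a - 1/(a+1) - 1/(a+1)^2] equals [1/(a (a+1)^2)]. *)
Lemma sum_inv_sqr_le r : \sum_(i < r.+1) i.+1%:R^-1 ^+ 2 <= 2 - r.+1%:R^-1 :> R.
Proof.
elim: r => [|r ih]; first by rewrite big_ord_recr big_ord0/= invr1; lra.
rewrite big_ord_recr/= (le_trans (lerD ih (lexx _)))//.
rewrite -[r.+2%:R]natr1; set a : R := r.+1%:R.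
have a0 : 0 < a by rewrite ltr0n.
rewrite -addrA lerD2l -subr_ge0.
rewrite (_ : _ - _ = (a * (a + 1) ^+ 2)^-1); last by field;
  rewrite !gt_eqF// addr_gt0.
by rewrite invr_ge0 mulr_ge0 ?exprn_ge0// ?addr_ge0// ltW.
Qed.

Lemma rule_step_ge0 tol M alpha rbar : 0 <= M ->
  constant_rule tol M alpha rbar \/ harmonic_rule tol M alpha rbar ->
  forall i, 0 <= alpha i.
Proof.
move=> M0 [[+ _]|[+ _]] i => ->; first by rewrite divr_ge0// sqrtr_ge0.
by rewrite divr_ge0.
Qed.

Lemma rule_step0 tol alpha rbar :
  constant_rule tol 0 alpha rbar \/ harmonic_rule tol 0 alpha rbar ->
  forall i, alpha i = 0.
Proof. by move=> [[+ _]|[+ _]] i => ->; rewrite mul0r. Qed.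

(** This inequality contradicts the potential bound. The sums have [rbar.+1] terms, one more than
    the actual updates. In the constant rule the squares sum to [M ^+ 2] and the extra term makes
    [M / tol < sqrt rbar.+1] strict. In the harmonic rule the 3 is 1 for the initial distance plus 2
    from [sum_inv_sqr_le]. *)
Lemma rule_step_sums tol M alpha rbar : 0 < tol -> 0 < M ->
  constant_rule tol M alpha rbar \/ harmonic_rule tol M alpha rbar ->
  M ^+ 2 + \sum_(i < rbar.+1) alpha i ^+ 2 <
  2 * tol * \sum_(i < rbar.+1) alpha i.
Proof.
move=> tol0 M0 [[alphaE [hr _]]|[alphaE [hr _]]].
- under eq_bigr do rewrite alphaE.
  under [in ltRHS]eq_bigr do rewrite alphaE.
  rewrite !sumr_const !card_ord.
  set s : R := Num.sqrt _.
  have r0 : 0 < rbar.+1%:R :> R by rewrite ltr0n.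
  have s0 : 0 < s by rewrite sqrtr_gt0.
  have sE : s ^+ 2 = rbar.+1%:R by rewrite sqr_sqrtr// ltW.
  have Ms : M / tol < s.
    rewrite -(@ltr_pXn2r _ 2)// ?nnegrE ?divr_ge0 ?ltW//.
    by rewrite sE expr_div_n (le_lt_trans hr)// ltr_nat.
  have -> : (M / s) ^+ 2 *+ rbar.+1 = M ^+ 2.
    by rewrite -mulr_natr -sE expr_div_n divfK// sqrf_eq0 gt_eqF.
  have -> : M / s *+ rbar.+1 = M * s.
    by rewrite -mulr_natr -sE; field; rewrite gt_eqF.
  have : M * M < M * (tol * s) by rewrite ltr_pM2l// mulrC -ltr_pdivrMr.
  by rewrite expr2; lra.
- pose A : R := \sum_(i < rbar.+1) i.+1%:R^-1.
  pose B : R := \sum_(i < rbar.+1) i.+1%:R^-1 ^+ 2.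
  have -> : \sum_(i < rbar.+1) alpha i ^+ 2 = M * M * B.
    by rewrite mulr_sumr; apply: eq_bigr => i _; rewrite alphaE -expr2 exprMn.
  have -> : \sum_(i < rbar.+1) alpha i = M * A.
    by rewrite mulr_sumr; apply: eq_bigr => i _; rewrite alphaE.
  have H : ln rbar.+1%:R < A.
    by rewrite (le_lt_trans (ln_le_harmonic _))//
      /A big_ord_recr/= ltrDl invr_gt0 ltr0n.
  have {H} : M * (2 * tol * ln rbar.+1%:R) < M * (2 * tol * A).
    by rewrite ltr_pM2l// ltr_pM2l// mulr_gt0.
  have : M * (M * (3 - rbar.+1%:R^-1)) <= M * (2 * tol * ln rbar.+1%:R).
    by rewrite ler_pM2l.
  have : M * (M * B) <= M * (M * (2 - rbar.+1%:R^-1)).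
    by rewrite !ler_pM2l// sum_inv_sqr_le.
  move: A B (ln _) (rbar.+1%:R^-1) => A B l r; rewrite expr2 => h1 h2 h3.
  lra.
Qed.

End StepSizes.

(** * Squared Euclidean distance *)

Section SquaredNorm.
Context {R : realType} {d : nat}.
Implicit Types (x g : 'rV[R]_d).

(** The potential needs an inner product, whereas steps and distances are measured in the 1-norm;
    [sqnorm_le_norm1] links the two. *)
Definition sqnorm x : R := \sum_(j < d) x 0 j ^+ 2.

Lemma sqnorm_ge0 x : 0 <= sqnorm x.
Proof. by apply: sumr_ge0 => j _; rewrite sqr_ge0. Qed.

Lemma sqnorm_le_norm1 x : sqnorm x <= norm1 x ^+ 2.
Proof.
rewrite expr2 /sqnorm {1}/norm1 mulr_suml; apply: ler_sum => j _.
rewrite -[leLHS]real_normK ?num_real// expr2 ler_wpM2l//.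
by rewrite /norm1 (bigD1 j)//= lerDl sumr_ge0.
Qed.

Lemma sqnorm_eq0 x : sqnorm x <= 0 -> x = 0.
Proof.
move=> x0; have /eqP : sqnorm x = 0 by apply/le_anti; rewrite x0 sqnorm_ge0.
rewrite psumr_eq0//; last by move=> j _; rewrite sqr_ge0.
move=> /allP x0'; apply/rowP => j; rewrite mxE; apply/eqP.
by rewrite -sqrf_eq0; apply: x0'; rewrite mem_index_enum.
Qed.

Lemma sqnorm_move x y (s : R) g :
  sqnorm (x - s *: g - y) =
  sqnorm (x - y) - 2 * s * (\sum_(j < d) g 0 j * (x - y) 0 j) + s ^+ 2 * sqnorm
    g.
Proof.
rewrite /sqnorm !mulr_sumr -sumrN -!big_split/=; apply: eq_bigr => j _.
by rewrite !mxE; ring.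
Qed.

End SquaredNorm.

(** * Away-step Frank-Wolfe iterations *)

Section AwayStep.
Context {R : realType} {d m : nat}.
Variable f : 'rV[R]_d -> 'rV[R]_m -> R.
Variables (n : nat) (z : nat -> 'rV[R]_m) (rho : R).
Implicit Types (x : 'rV[R]_d) (y : 'M[R]_(n, m)) (w : weights R m n)
  (I : {set vtx m n}).

Lemma convex_weights_le1 I w i : convex_weights I w -> w i <= 1.
Proof.
move=> [w0 _ <-]; rewrite (bigD1 i)//= lerDl.
by apply: sumr_ge0 => j _; exact: w0.
Qed.

Lemma convex_weights_in I w i : convex_weights I w -> 0 < w i -> i \in I.
Proof.
move=> [_ wI _] wi; apply/negPn/negP => /wI wi0.
by rewrite wi0 ltxx in wi.
Qed.

Lemma convex_weights_pos I w : convex_weights I w -> exists i, 0 < w i.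
Proof.
move=> [w0 _ w1]; apply/not_existsP => h.
move: w1; rewrite big1; first by move/eqP; rewrite eq_sym oner_eq0.
by move=> i _; apply/le_anti; rewrite w0 andbT leNgt; apply/negP/h.
Qed.

Lemma convex_weights_dirac I i : i \in I ->
  convex_weights I [ffun j => (j == i)%:R : R].
Proof.
move=> iI; split=> [j|j jI|].
- by rewrite ffunE ler0n.
- by rewrite ffunE; case: eqP jI => // ->; rewrite iI.
- rewrite (bigD1 i)//= ffunE eqxx big1 ?addr0// => j /negPf ji.
  by rewrite ffunE ji.
Qed.

Lemma sum_dirac (i : vtx m n) : \sum_j (j == i)%:R = 1 :> R.
Proof.
by rewrite (bigD1 i)//= eqxx big1 ?addr0// => j /negPf ->.
Qed.

Lemma afw_step_convex x I w w' : convex_weights I w ->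
  afw_step f z rho x I w w' -> convex_weights I w'.
Proof.
move=> cw [s [v [[sI _] [wv _]]]] [t [t01 _ ->]].
have vI := convex_weights_in cw wv.
case: (cw) => w0 wI w1.
split=> [i|i iI|].
- rewrite ffunE; case: ifP t01 => _ /andP[t0 t1].
    rewrite (_ : _ + _ = (1 - t) * w i + t * (i == s)%:R); last by ring.
    by rewrite addr_ge0 ?mulr_ge0// subr_ge0.
  rewrite mulrBr; case: eqP => [->|_]; last first.
    by rewrite mulr0 subr0 addr_ge0// mulr_ge0.
  rewrite mulr1; have := convex_weights_le1 v cw.
  (* If [w v = 1] then [tmax] divides by 0, but the away direction vanishes at [v] and the weight
     stays 1. *)
  rewrite le_eqVlt => /orP[/eqP ->|wv1]; first by lra.
  by move: t1; rewrite ler_pdivlMr ?subr_gt0//; lra.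
- have is_ : (i == s) = false by apply: contraNF iI => /eqP ->.
  have iv : (i == v) = false by apply: contraNF iI => /eqP ->.
  by rewrite ffunE is_ iv wI// mulr0n subr0 if_same mulr0 addr0.
- under eq_bigr do rewrite ffunE.
  rewrite big_split/= -mulr_sumr w1 (_ : \sum_i _ = 0) ?mulr0 ?addr0//.
  move: (_ <= _) => b; case: b => /=; rewrite sumrB w1 sum_dirac subrr//.
Qed.

Hypothesis f_diff : forall x (q y : 'rV[R]_m), differentiable (hfun f x q) y.

(** The two vertices are extremal over finite nonempty sets; the step length comes from the extreme
    value theorem on [[0, tmax]]. *)
Lemma afw_step_exists x I w : convex_weights I w ->
  exists w', afw_step f z rho x I w w'.
Proof.
move=> cw; pose q := score f z x (n%:R * rho) w.
have [v0 wv0] := convex_weights_pos cw.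
have v0I := convex_weights_in cw wv0.
have [s sI smax] := @arg_maxP _ R _ v0 (mem I) q v0I.
have [v wv vmin] := @arg_minP _ R _ v0 (fun i => 0 < w i) q wv0.
pose toward := pairing q w - q v <= q s - pairing q w.
pose dir i := if toward then (i == s)%:R - w i else w i - (i == v)%:R.
pose tmax := if toward then 1 else w v / (1 - w v).
have tmax0 : 0 <= tmax.
  rewrite /tmax; case: ifP => // _; rewrite divr_ge0 ?(ltW wv)// subr_ge0.
  exact: convex_weights_le1 cw.
pose move t : weights R m n := [ffun i => w i + t * dir i].
have oc : continuous (fun t : R => objective f z x (displacement (n%:R * rho)
  (move t))).
  rewrite /move; under eq_fun do rewrite displacement_move.
  exact: objective_line_continuous.
have [t t01 tm] := EVT_max tmax0 (continuous_subspaceT oc).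
rewrite in_itv/= in t01.
exists (move t), s, v; split.
- by split=> // i iI; exact: smax.
- by split=> // i wi; exact: vmin.
- exists t; split => // t' t'01; apply: tm; by rewrite in_itv.
Qed.

End AwayStep.

(** * One period of the algorithm *)

Lemma seq_argmin {R : realType} {T : eqType} (F : T ->
  \bar R) (x0 : T) (s : seq T) :
  exists2 x, x \in x0 :: s & forall x', x' \in x0 :: s -> (F x <= F x')%E.
Proof.
elim: s => [|y s [x xs xmin]].
  by exists x0; rewrite ?mem_head// => x'; rewrite inE => /eqP ->.
have [Fxy|/ltW Fyx] := leP (F x) (F y).
- exists x; first by move: xs; rewrite !inE => /orP[->|->]//; rewrite !orbT.
  move=> x'; rewrite !inE => /or3P[/eqP ->|/eqP ->//|x's].
    by apply: xmin; rewrite mem_head.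
  by apply: xmin; rewrite inE x's orbT.
- exists y; first by rewrite !inE eqxx orbT.
  move=> x'; rewrite !inE => /or3P[/eqP ->|/eqP ->//|x's];
    apply: (le_trans Fyx).
    by apply: xmin; rewrite mem_head.
  by apply: xmin; rewrite inE x's orbT.
Qed.

Section Period.
Context {R : realType} {d m : nat}.
Variables (f : 'rV[R]_d -> 'rV[R]_m -> R) (sg : 'rV[R]_d ->
  'rV[R]_m -> 'rV[R]_d).
Variables (Z : set 'rV[R]_m) (eps1 epsSA : R) (n : nat) (z : nat ->
  'rV[R]_m) (rho : R).
Variables (alpha : nat -> R) (rbar : nat).
Hypotheses (n_gt0 : (0 < n)%N) (m_gt0 : (0 < m)%N) (rho_ge0 : 0 <= rho).
Hypothesis f_diff : forall x (q y : 'rV[R]_m), differentiable (hfun f x q) y.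
Hypothesis f_concave :
  forall x q, convex_function [set: 'rV[R]_m] (- hfun f x q).
Hypothesis certificate_P1 :
  forall x, certificate f Z rho n z x = P1_value f n rho z x.
Hypothesis eps1_le : eps1 <= epsSA.

Local Notation J := (certificate f Z rho n z).
Local Notation stp := (step f sg Z eps1 epsSA z rho alpha rbar).
Local Notation reachable := (reach f sg Z eps1 epsSA z rho alpha rbar).
Implicit Types (x : 'rV[R]_d) (y : 'M[R]_(n, m)) (s : state R d m n).

Definition Jr x : R := fine (J x).

(** Bounded below by the feasible point 0 of (P1), and above by the gap at 0. *)
Lemma certificate_fin x : J x = (Jr x)%:E.
Proof.
rewrite /Jr fineK// certificate_P1 fin_numElt; apply/andP; split.
  apply: (@lt_le_trans _ _ (objective f z x (0 : 'M[R]_(n, m)))%:E).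
    by rewrite ltNyr.
  by apply: ereal_sup_ubound; exists 0 => //; exact: feasible0.
have [i iS] := search_set_neq0 f z x (0 : 'M[R]_(n, m)) n_gt0 m_gt0.
apply: (@le_lt_trans _ _ (objective f z x (0 : 'M[R]_(n,
  m)) + gap f z rho x 0 i)%:E).
  apply: ge_ereal_sup => _ [y yf <-]; rewrite lee_fin.
  exact: objective_le_gap.
by rewrite ltry.
Qed.

Lemma objective_le_certificate x y : feasible rho y ->
  objective f z x y <= Jr x.
Proof.
move=> yf; rewrite -lee_fin -certificate_fin certificate_P1.
by apply: ereal_sup_ubound; exists y.
Qed.

(** What a passed gap test certifies; used with both tolerances [eps1] and [epsSA]. *)
Lemma certificate_le_gap x y i e : i \in search_set f z x y ->
  gap f z rho x y i <= e -> Jr x <= objective f z x y + e.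
Proof.
move=> iS ge; rewrite -lee_fin -certificate_fin certificate_P1.
apply: ge_ereal_sup => _ [y' yf <-]; rewrite lee_fin.
by rewrite (le_trans (objective_le_gap f_diff f_concave n_gt0 iS yf))// lerD2l.
Qed.

(** The invariant behind progress: [st_it s <= rbar] leaves either an update or the selection
    available, and the history must be feasible since selection restores a recorded [y]. *)
Definition well_formed s : Prop :=
  [/\ feasible rho (st_y s), forall p, p \in st_hist s -> feasible rho p.2,
      (st_it s <= rbar)%N &
      if st_phase s is Solve _ w then convex_weights (st_I s) w else True].

Lemma step_well_formed s k s' : well_formed s -> stp s k s' -> well_formed s'.
Proof.
move=> + st; case: st => [it x y I h i _ _|it x y I h i _ _|it x y I h b i _ _
  |it x y I h b i w _ _ cw|it x y I h b w w' _ aw|it x y I h b w _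
  |it x y I h it_lt|x y I h p ph _]; rewrite /well_formed/= => -[yf hf itr cw0];
    split => //.
- by case: b.
- exact: afw_step_convex aw.
- exact: feasible_displacement cw0.
- by move=> p; rewrite mem_rcons inE => /orP[/eqP ->//|/hf].
- by move: ph; rewrite mem_rcons inE => /orP[/eqP ->//|/hf].
- by move=> p'; rewrite mem_rcons inE => /orP[/eqP ->//|/hf].
Qed.

Lemma step_exists s : well_formed s -> st_phase s <> Stop ->
  exists k s', stp s k s'.
Proof.
case: s => it x y I h ph [/= yf hf itr cw] nstop.
have [i iS] := search_set_neq0 f z x y n_gt0 m_gt0.
case: ph cw nstop => [|b|b w| |]//= cw _.
- have [g|g] := leP (gap f z rho x y i) epsSA.
    by exists 0%N; eexists; exact: step_reuse g.
  by exists 0%N; eexists; exact: step_regenerate g.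
- have [g|g] := leP (gap f z rho x y i) eps1.
    by exists 0%N; eexists; exact: step_accept g.
  (* AFWA may start at any convex weights; a point mass at a vertex just found will do. *)
  have cw1 : convex_weights (I :|: search_set f z x y) [ffun j => (j == i)%:R :
    R].
    by apply: convex_weights_dirac; rewrite finset.in_setU iS orbT.
  by exists 0%N; eexists; exact: step_enlarge iS g cw1.
- have [done|ndone] := pselect (afw_done f eps1 z rho x I w).
    by exists 0%N; eexists; exact: step_solved.
  have [w' aw] := afw_step_exists z rho f_diff x cw.
  by exists 1%N; eexists; exact: step_afw ndone aw.
- move: itr; rewrite leq_eqVlt => /orP[/eqP ->|itr].
    have [p ph pmin] := seq_argmin (fun p : 'rV[R]_d * 'M[R]_(n,
      m) => J p.1) (x, y) h.
    exists 0%N; eexists; apply: (@step_select _ _ _ _ _ _ _ _ _ _ _ _ _ x y I h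
      p).
      by rewrite mem_rcons.
    by move=> p'; rewrite mem_rcons; exact: pmin.
  by exists 1%N; eexists; exact: step_update.
Qed.

Lemma reach_well_formed s k s' : well_formed s ->
  reachable s k s' -> well_formed s'.
Proof.
move=> ws; elim=> [//|k1 s1 k2 s2 _ ih st]; exact: step_well_formed ih st.
Qed.

Lemma init_well_formed x I : well_formed (period_init x I).
Proof. by split => //; exact: feasible0. Qed.

(* In a slow stream no move can exceed the length of the period, so the state
   at its end is one from which no move exists at all. *)
Lemma period_end_stop T x I s :
  (phi f sg Z eps1 epsSA z rho alpha rbar x I <= T%:R%:E)%E ->
  period_end f sg Z eps1 epsSA z rho alpha rbar T x I s ->
  st_phase s = Stop.
Proof.
move=> phiT [k [rs kT smax]]; apply: contrapT => nstop.
have [k' [s' st]] := step_exists (reach_well_formed (init_well_formed x I) rs)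
  nstop.
have := smax _ _ st; rewrite ltnNge => /negP; apply.
rewrite -(ler_nat R) -lee_fin (le_trans _ phiT)//.
apply: ereal_sup_ubound; exists (k + k')%N => //.
by exists s'; exact: reach_step rs st.
Qed.

(** * Convergence of the subgradient iterations *)

Variables (xstar : 'rV[R]_d) (M L eps2 : R).
Let mu := Num.max L 1.
Let tol := eps2 / mu - epsSA.
Hypothesis sg_subgradient : forall x q x',
  f x q + \sum_(j < d) sg x q 0 j * (x' - x) 0 j <= f x' q.
Hypothesis epsSA_ge0 : 0 <= epsSA.
Hypothesis tol_gt0 : 0 < tol.
Hypothesis rule : constant_rule tol M alpha rbar \/
  harmonic_rule tol M alpha rbar.

Lemma subgradient_le x y x' :
  objective f z x y + \sum_(j < d) subgradient sg z x y 0 j * (x' - x) 0 j <=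
  objective f z x' y.
Proof.
have -> : \sum_(j < d) subgradient sg z x y 0 j * (x' - x) 0 j =
    n%:R^-1 * \sum_(k < n) \sum_(j < d) sg x (z k - row k y) 0 j * (x' - x) 0 j.
  rewrite exchange_big/= mulr_sumr; apply: eq_bigr => j _.
  by rewrite /subgradient mxE summxE -mulrA mulr_suml.
rewrite /objective -mulrDr -big_split/= ler_wpM2l ?invr_ge0//.
by apply: ler_sum => k _; exact: sg_subgradient.
Qed.

(** Expand the square: the cross term gains at least [2 * tol * a], because [x] is far from optimal,
    and the normalization keeps the quadratic term below [a ^+ 2]. *)
Lemma subgradient_step x y a : feasible rho y -> 0 <= a ->
  Jr x <= objective f z x y + epsSA ->
  norm1 (subgradient sg z x y) <= L -> Jr xstar + eps2 < Jr x ->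
  let g := subgradient sg z x y in
  sqnorm (x - (a / Num.max (norm1 g) 1) *: g - xstar) + 2 * tol * a <=
  sqnorm (x - xstar) + a ^+ 2.
Proof.
move=> yf a0 Jle gL far /=; set g := subgradient sg z x y; rewrite sqnorm_move.
set M' := Num.max _ _.
have M'1 : 1 <= M' by rewrite le_max lexx orbT.
have M'0 : 0 < M' by rewrite (lt_le_trans ltr01).
have mu1 : 1 <= mu by rewrite le_max lexx orbT.
have mu0 : 0 < mu by rewrite (lt_le_trans ltr01).
have M'mu : M' <= mu by rewrite ge_max !le_max gL lexx orbT.
set s := a / M'.
have s0 : 0 <= s by rewrite divr_ge0// ltW.
have aE : a = s * M' by rewrite divfK// gt_eqF.
have eps2E : eps2 = (tol + epsSA) * mu by rewrite subrK divfK// gt_eqF.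
have gE : \sum_(j < d) g 0 j * (x - xstar) 0 j =
    - \sum_(j < d) g 0 j * (xstar - x) 0 j.
  by rewrite -sumrN; apply: eq_bigr => j _; rewrite -mulrN !mxE opprB.
(* The objective at [(xstar, y)] is at most [Jr xstar], and at [(x, y)] at least [Jr x - epsSA]. *)
have h1 : eps2 - epsSA <= \sum_(j < d) g 0 j * (x - xstar) 0 j.
  rewrite gE; have := subgradient_le x y xstar.
  have := objective_le_certificate xstar yf; rewrite -/g; lra.
have h2 : sqnorm g <= M' ^+ 2.
  rewrite (le_trans (sqnorm_le_norm1 g))//
    ler_sqr ?nnegrE ?norm1_ge0 ?(ltW M'0)//.
  by rewrite /M' le_max lexx.
(* As [eps2 = (tol + epsSA) * mu], this follows from [M' <= mu], [1 <= mu] and [0 <= epsSA]. *)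
have h3 : tol * M' <= eps2 - epsSA.
  rewrite eps2E.
  have : tol * M' <= tol * mu by rewrite ler_pM2l.
  have : epsSA * 1 <= epsSA * mu by rewrite ler_wpM2l.
  lra.
have h4 : s * (tol * M') <= s * \sum_(j < d) g 0 j * (x - xstar) 0 j.
  by rewrite ler_wpM2l// (le_trans h3).
have h5 : s ^+ 2 * sqnorm g <= a ^+ 2.
  by rewrite aE [leRHS]exprMn ler_wpM2l// sqr_ge0.
have h6 : tol * a = s * (tol * M') by rewrite aE; ring.
move: h4 h5; rewrite -h6; lra.
Qed.

(** The bound [L] is assumed only for the history at the end of the period, so it is made part of
    this contradiction hypothesis and discharged there. *)
Definition unsolved (h : seq ('rV[R]_d * 'M[R]_(n, m))) : Prop :=
  forall p, p \in h ->
    norm1 (subgradient sg z p.1 p.2) <= L /\ Jr xstar + eps2 < Jr p.1.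

Definition potential_bound it x h : Prop := unsolved h ->
  sqnorm (x - xstar) + 2 * tol * (\sum_(i < it) alpha i) <=
  M ^+ 2 + \sum_(i < it) alpha i ^+ 2.

Definition best_selected x h : Prop :=
  ~ unsolved h /\ forall p, p \in h -> Jr x <= Jr p.1.

(** Accuracy of [y] at [x] is claimed only right after a passed gap test: [epsSA] in [Update],
    [eps1] in [Stop]. The potential is tracked up to the selection, and its outcome afterwards. *)
Definition progress s : Prop :=
  match st_phase s with
  | Check | Search false | Solve false _ =>
      potential_bound (st_it s) (st_x s) (st_hist s)
  | Update => potential_bound (st_it s) (st_x s) (st_hist s) /\
      Jr (st_x s) <= objective f z (st_x s) (st_y s) + epsSA
  | Search true | Solve true _ => best_selected (st_x s) (st_hist s)
  | Stop => best_selected (st_x s) (st_hist s) /\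
      Jr (st_x s) <= objective f z (st_x s) (st_y s) + eps1
  end.

Lemma unsolved_rcons h p : unsolved (rcons h p) ->
  unsolved h /\ (norm1 (subgradient sg z p.1 p.2) <=
    L /\ Jr xstar + eps2 < Jr p.1).
Proof.
move=> u; split=> [q qh|]; apply: u; rewrite mem_rcons ?mem_head//.
by rewrite inE qh orbT.
Qed.

Hypothesis M_ge0 : 0 <= M.
Hypothesis eps2_ge0 : 0 <= eps2.

Lemma potential_update it x y h : feasible rho y ->
  Jr x <= objective f z x y + epsSA -> potential_bound it x h ->
  let g := subgradient sg z x y in
  potential_bound it.+1 (x - (alpha it /
    Num.max (norm1 g) 1) *: g) (rcons h (x, y)).
Proof.
move=> yf Jle pb g /unsolved_rcons[/= uh [gL far]].
have := subgradient_step yf (rule_step_ge0 M_ge0 rule it) Jle gL far.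
rewrite /= -/g !big_ord_recr/= => h1; have := pb uh; lra.
Qed.

(* Were no iterate eps2-optimal, a further (virtual) step from the last one
   would make the potential negative. *)
Lemma not_unsolved x y h : feasible rho y ->
  Jr x <= objective f z x y + epsSA -> potential_bound rbar x h ->
  ~ unsolved (rcons h (x, y)).
Proof.
move=> yf Jle pb u; have [uh [_ far]] := unsolved_rcons u.
move: M_ge0; rewrite le_eqVlt => /orP[/eqP M0|M0]; last first.
  have := potential_update yf Jle pb u; have := rule_step_sums tol_gt0 M0 rule.
  have := sqnorm_ge0 (x - (alpha rbar /
    Num.max (norm1 (subgradient sg z x y)) 1) *:
    subgradient sg z x y - xstar).
  lra.
(* If [M = 0], the potential bound forces [x = xstar], which is optimal. *)
have al0 i : alpha i = 0 by move: rule; rewrite -M0 => /rule_step0.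
have := pb uh; rewrite -M0 expr0n/= big1; last by move=> i _; rewrite al0.
rewrite big1; last by move=> i _; rewrite al0 expr0n.
rewrite mulr0 !addr0 => /sqnorm_eq0/eqP; rewrite subr_eq0 => /eqP xE.
by move: far; rewrite /= xE ltNge lerDl eps2_ge0.
Qed.

Lemma step_progress s k s' : well_formed s ->
  stp s k s' -> progress s -> progress s'.
Proof.
move=> + st; case: st => [it x y I h i iS ge|it x y I h i iS ge|it x y I h b i
  iS ge
  |it x y I h b i w _ _ cw|it x y I h b w w' _ aw|it x y I h b w _
  |it x y I h it_lt|x y I h p ph pmin];
    rewrite /well_formed/progress/= => -[yf hf itr cw0].
- by move=> pb; split => //; exact: certificate_le_gap ge.
- by [].
(* C-Gen accepts at [eps1], which is within the [epsSA] that [Update] requires. *)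
- case: b => pb; split=> //; apply: certificate_le_gap iS _ => //.
  exact: le_trans eps1_le.
- by case: b.
- by case: b.
- by case: b.
- by move=> [pb Jle]; exact: potential_update.
- move=> [pb Jle]; split; first exact: not_unsolved.
  by move=> p' /pmin; rewrite !certificate_fin lee_fin.
Qed.

Lemma period_correct T x I s : norm1 (x - xstar) <= M ->
  (phi f sg Z eps1 epsSA z rho alpha rbar x I <= T%:R%:E)%E ->
  period_end f sg Z eps1 epsSA z rho alpha rbar T x I s ->
  (forall p, p \in st_hist s -> norm1 (subgradient sg z p.1 p.2) <= L) ->
  [/\ st_phase s = Stop, feasible rho (st_y s),
      Jr (st_x s) <= objective f z (st_x s) (st_y s) + eps1 &
      Jr (st_x s) <= Jr xstar + eps2].
Proof.
move=> xM phiT pe hL; have stop := period_end_stop phiT pe.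
have [k [rs _ _]] := pe.
have [yf hf _ _] := reach_well_formed (init_well_formed x I) rs.
have prog : progress s.
  have : progress (period_init x I).
    move=> _; rewrite !big_ord0/= mulr0 !addr0 (le_trans (sqnorm_le_norm1 _))//.
    by rewrite ler_sqr ?nnegrE ?norm1_ge0.
  move=> p0; elim: rs => [//|k1 s1 k2 s2 rs1 ih st].
  apply: step_progress st ih;
    exact: reach_well_formed (init_well_formed x I) rs1.
move: prog; rewrite /progress stop => -[[ns smin] Jle]; split => //.
(* The decision minimizes [Jr] over the history: were it not eps2-optimal, no recorded iterate would
   be. *)
rewrite leNgt; apply/negP => far; apply: ns => p ph; split; first exact: hL.
by rewrite (lt_le_trans far)// smin.
Qed.

End Period.

(** * Lipschitz sup-convolutions *)

Section SupConvolution.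
Context {R : realType} {m : nat}.
Implicit Types (S : set 'rV[R]_m) (h g : 'rV[R]_m ->
  R) (K C : R) (q : 'rV[R]_m).

Definition lipschitz1 K g := forall q q', `|g q - g q'| <= K * norm1 (q - q').

(* The least K-Lipschitz function above h on S, when there is one. *)
Definition sup_convolution K S h q : R :=
  sup [set h q' - K * norm1 (q - q') | q' in S].

Section theory.
Variables (K : R) (S : set 'rV[R]_m) (h : 'rV[R]_m -> R).
Hypotheses (K_ge0 : 0 <= K) (S_nonempty : S !=set0).
Hypothesis bounded : exists q0 C, forall q, S q ->
  h q - K * norm1 (q0 - q) <= C.
Local Notation hK := (sup_convolution K S h).

(** A cone bound centered at [q0] gives one at any [q], at the price of [K * norm1 (q0 - q)]. *)
Lemma has_sup_convolution q : has_sup [set h q' - K * norm1 (q - q') | q' in S].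
Proof.
split; first by case: S_nonempty => q' Sq'; exists (h q' - K * norm1 (q - q')),
  q'.
have [q0 [C hC]] := bounded.
exists (C + K * norm1 (q0 - q)) => _ [q' Sq' <-].
have := hC _ Sq'.
have : K * norm1 (q0 - q') <= K * (norm1 (q0 - q) + norm1 (q - q')).
  by rewrite ler_wpM2l// norm1_sub.
lra.
Qed.

Lemma sup_convolution_ge q q' : S q' -> h q' - K * norm1 (q - q') <= hK q.
Proof.
by move=> Sq'; apply: (sup_upper_bound (has_sup_convolution q)); exists q'.
Qed.

Lemma sup_convolution_le q C :
  (forall q', S q' -> h q' - K * norm1 (q - q') <= C) -> hK q <= C.
Proof.
move=> hC; apply: ge_sup; last by move=> _ [q' Sq' <-]; exact: hC.
by case: (has_sup_convolution q).
Qed.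

Lemma le_sup_convolution q : S q -> h q <= hK q.
Proof.
by move=> Sq; have := sup_convolution_ge q Sq;
  rewrite subrr /norm1 big1 ?mulr0 ?subr0// => j _; rewrite mxE normr0.
Qed.

Lemma sup_convolution_id q : S q ->
  (forall q', S q' -> h q' <= h q + K * norm1 (q - q')) -> hK q = h q.
Proof.
move=> Sq hq; apply/le_anti; rewrite le_sup_convolution// andbT.
by apply: sup_convolution_le => q' Sq'; rewrite lerBlDr hq.
Qed.

(** A finite supremum of K-Lipschitz functions of [q]. *)
Lemma sup_convolution_lipschitz : lipschitz1 K hK.
Proof.
suff H q q' : hK q - hK q' <= K * norm1 (q - q').
  by move=> q q'; rewrite ler_norml H andbT lerNl opprB -norm1N opprB.
rewrite lerBlDr; apply: sup_convolution_le => p Sp.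
have := sup_convolution_ge q' Sp.
have : K * norm1 (q' - p) <= K * (norm1 (q' - q) + norm1 (q - p)).
  by rewrite ler_wpM2l// norm1_sub.
rewrite -(norm1N (q' - q)) opprB; lra.
Qed.

End theory.

Lemma norm1_continuous : continuous (@norm1 R m).
Proof.
move=> q; rewrite /norm1.
apply: (@cvg_big _ _ +%R 0 _ (@add_continuous R^o) _ _ _ _ _ (nbhs_filter q)).
move=> j _; apply: cvg_norm; exact: coord_continuous.
Qed.

Lemma norm1_0 : norm1 (0 : 'rV[R]_m) = 0.
Proof. by rewrite /norm1 big1// => j _; rewrite mxE normr0. Qed.

Lemma lipschitz1_continuous K g : lipschitz1 K g -> continuous g.
Proof.
move=> gK q; apply/(@cvgrPdist_le _ _ _ _ (nbhs_filter q)) => e e0.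
have hc : K * norm1 (q - q') @[q' --> q] --> 0.
  rewrite -[X in _ --> X](mulr0 K) -norm1_0 -[X in norm1 X](subrr q).
  apply: (@cvgM _ _ _ (nbhs_filter q)); first exact: cvg_cst.
  apply: (@continuous_comp _ _ _ (fun q' => q - q') (@norm1 R m));
    last exact: norm1_continuous.
  by apply: (@cvgB _ _ _ _ (nbhs_filter q)); [exact: cvg_cst|exact: cvg_id].
have := @cvgr_le _ _ _ (nbhs_filter q) _ _ hc _ e0; apply: filterS => q' h;
  exact: le_trans (gK _ _) h.
Qed.

Lemma continuous_measurable_borelRV g : continuous g ->
  measurable_fun [set: borelRV R m] (g : borelRV R m -> R).
Proof.
move=> gc.
apply: (measurability _ (measurable_realfun.RGenOpens.measurableE R)).
move=> _ [_ [a [b ->] <-]]; rewrite setTI; apply: sub_sigma_algebra.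
by apply: open_comp => // x _; exact: gc.
Qed.

End SupConvolution.

(** * The Wasserstein distance *)

Section Wasserstein.
Context {R : realType} {m : nat}.
Implicit Types (mu nu : {measure set (borelRV R m) -> \bar R}).
Implicit Types (g : 'rV[R]_m -> R).
Implicit Types (Z : set 'rV[R]_m) (K : R).
Local Open Scope ereal_scope.

(** Stated for measures, so as to cover [empirical] too; finite mass makes constants integrable. *)
Definition finite_first_moment mu : Prop :=
  mu setT < +oo /\ \int[mu]_q (norm1 q)%:E < +oo.

Lemma lipschitz1_measurable K g : lipschitz1 K g ->
  measurable_fun [set: borelRV R m] (g : borelRV R m -> R).
Proof.
by move=> /lipschitz1_continuous; exact: continuous_measurable_borelRV.
Qed.

Lemma measurable_norm1 :
  measurable_fun [set: borelRV R m] (@norm1 R m : borelRV R m -> R).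
Proof. by apply: continuous_measurable_borelRV; exact: norm1_continuous. Qed.

(** Domination by [|g 0| + K * norm1 q]. *)
Lemma lipschitz1_integrable mu K g : finite_first_moment mu ->
  (0 <= K)%R -> lipschitz1 K g ->
  mu.-integrable [set: borelRV R m] (EFin \o g).
Proof.
move=> [muT mu1] K0 gK; apply/integrableP; split.
  by apply/measurable_EFinP; exact: (lipschitz1_measurable gK).
have mn : measurable_fun [set: borelRV R m] (fun q => (norm1 q)%:E).
  by apply/measurable_EFinP; exact: measurable_norm1.
have n0 (q : borelRV R m) : [set: borelRV R m] q -> 0 <= (norm1 q)%:E.
  by rewrite lee_fin norm1_ge0.
have Kn0 (q : borelRV R m) : [set: borelRV R m] q -> 0 <= K%:E * (norm1 q)%:E.
  by rewrite -EFinM lee_fin mulr_ge0// norm1_ge0.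
have mKn : measurable_fun [set: borelRV R m] (fun q => K%:E * (norm1 q)%:E).
  exact: measurable_funeM.
apply: (@le_lt_trans _ _ (\int[mu]_q (`|g 0%R|%:E + K%:E * (norm1 q)%:E))).
  apply: ge0_le_integral => //=; last first.
  - move=> q _; rewrite -EFinM -EFinD lee_fin.
    by have := gK q 0%R; rewrite subr0; have :=
      ler_normD (g q - g 0%R)%R (g 0%R); rewrite subrK; lra.
  - exact: emeasurable_funD.
  - by apply/measurable_EFinP/measurableT_comp => //;
    exact: lipschitz1_measurable gK.
rewrite ge0_integralD// integral_cst// ge0_integralZl// lte_add_pinfty//.
  exact: lte_mul_pinfty.
exact: lte_mul_pinfty.
Qed.

Lemma finite_first_moment_probability (Q : probability (borelRV R m) R) :
  \int[Q]_q (norm1 q)%:E < +oo -> finite_first_moment Q.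
Proof. by split=> //=; rewrite probability_setT ltry. Qed.

Lemma finite_first_moment_empirical n (z : nat -> 'rV[R]_m) :
  finite_first_moment (empirical n z).
Proof.
split.
  rewrite /empirical /= /mscale/= /msum.
  apply: lte_mul_pinfty => //; apply/lte_sum_pinfty => i _.
  have dT : (@dirac _ (borelRV R m) (z i) R) setT = 1 by exact: diracT.
  by rewrite [X in X < _]dT ltry.
have mn : measurable_fun [set: borelRV R m] (fun q => (norm1 q)%:E).
  by apply/measurable_EFinP; exact: measurable_norm1.
have nn (q : borelRV R m) : [set: borelRV R m] q -> 0 <= (norm1 q)%:E.
  by rewrite lee_fin norm1_ge0.
rewrite /empirical ge0_integral_mscale//.
apply: lte_mul_pinfty => //.
rewrite ge0_integral_measure_sum//.
apply/lte_sum_pinfty => i _.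
by rewrite integral_dirac// diracT mul1e ltry.
Qed.

Lemma lipschitz1Z K g (c : R) : lipschitz1 K g ->
  lipschitz1 (`|c| * K)%R (fun q => c * g q)%R.
Proof.
by move=> gK q q'; rewrite -mulrBr normrM -mulrA ler_wpM2l.
Qed.

Lemma measurable_closed_borelRV Z : closed Z ->
  measurable (Z : set (borelRV R m)).
Proof.
move=> Zc; rewrite -[Z]setCK; apply: measurableC.
by apply: sub_sigma_algebra; exact: closed_openC.
Qed.

(** [g / K] is an admissible test function; integrability makes the subtraction and the scaling by
    [K] legitimate. *)
Lemma wasserstein_lipschitz Z mu nu K (r : R) g : closed Z ->
  finite_first_moment mu -> finite_first_moment nu ->
  wasserstein Z mu nu <= r%:E -> (0 < K)%R -> lipschitz1 K g ->
  \int[mu]_(q in Z) (g q)%:E <= \int[nu]_(q in Z) (g q)%:E + (K * r)%:E.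
Proof.
move=> Zc muf nuf Wr K0 gK.
have mZ := measurable_closed_borelRV Zc.
have intg (la : {measure set (borelRV R m) ->
  \bar R}) : finite_first_moment la ->
    la.-integrable (Z : set (borelRV R m)) (EFin \o g).
  move=> laf; apply: (@integrableS _ _ _ _ setT) => //.
  by apply: lipschitz1_integrable laf _ gK; exact: ltW.
have imu := intg _ muf; have inu := intg _ nuf.
have fmu := integrable_fin_num mZ imu; have fnu := integrable_fin_num mZ inu.
rewrite -leeBlDl// -(@lee_pmul2l _ K^-1%:E)//; last first.
  by rewrite lte_fin invr_gt0.
rewrite -EFinM mulKf ?gt_eqF// (le_trans _ Wr)//.
apply: ereal_sup_ubound; exists (fun q => K^-1 * g q)%R => /=.
  move=> q q' _ _; have := lipschitz1Z K^-1 gK q q'.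
  by rewrite (@ger0_norm _ K^-1) ?invr_ge0 ?(ltW K0)// mulVf ?gt_eqF// mul1r.
under eq_integral do rewrite EFinM.
under [X in _ - X]eq_integral do rewrite EFinM.
by rewrite !integralZl// [RHS]muleBr//; apply: fin_num_adde_defr; exact: fmu.
Qed.

(* Test functions need only be Lipschitz on Z; their McShane extension makes
   them integrable, hence their sign reversible under the integrals. *)
Lemma wasserstein_sym Z mu nu : closed Z -> Z !=set0 ->
  finite_first_moment mu -> finite_first_moment nu ->
  wasserstein Z mu nu <= wasserstein Z nu mu.
Proof.
move=> Zc [q0 Zq0] muf nuf; have mZ := measurable_closed_borelRV Zc.
apply: ge_ereal_sup => _ [g /= gZ <-].
pose G := sup_convolution 1 Z g.
have bounded : exists q0 C, forall q, Z q -> (g q - 1 * norm1 (q0 - q) <= C)%R.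
  exists q0, (g q0) => q Zq; rewrite lerBlDl mul1r -lerBlDr.
  by rewrite (le_trans (ler_norm _))// (le_trans (gZ _ _ Zq Zq0))//
    -norm1N opprB.
have Gg q : Z q -> G q = g q.
  move=> Zq; apply: sup_convolution_id => //; first by exists q0.
  move=> q' Zq'; rewrite mul1r -lerBlDl (le_trans (ler_norm _))//.
  by rewrite (le_trans (gZ _ _ Zq' Zq))// -norm1N opprB.
have GL : lipschitz1 1 G by apply: sup_convolution_lipschitz => //; exists q0.
have intN (la : {measure set (borelRV R m) ->
  \bar R}) : finite_first_moment la ->
    (\int[la]_(q in Z) (- g q)%:E = - (\int[la]_(q in Z) (g q)%:E)) /\
    ((\int[la]_(q in Z) (g q)%:E) \is a fin_num).
  move=> laf.
  have iG : la.-integrable (Z : set (borelRV R m)) (EFin \o G).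
    by apply: (@integrableS _ _ _ _ setT) => //;
      exact: lipschitz1_integrable laf _ GL.
  have -> : \int[la]_(q in Z) (g q)%:E = \int[la]_(q in Z) (EFin \o G) q.
    by apply: eq_integral => q /[!inE] Zq /=; rewrite Gg.
  have -> : \int[la]_(q in Z) (- g q)%:E = \int[la]_(q in Z) - (EFin \o G) q.
    by apply: eq_integral => q /[!inE] Zq /=; rewrite Gg.
  split; first by rewrite integralN//; exact: integrable_add_def.
  exact: integrable_fin_num.
have [muN muF] := intN _ muf; have [nuN nuF] := intN _ nuf.
apply: ereal_sup_ubound; exists (fun q => - g q)%R => /=.
  by move=> q q' Zq Zq'; rewrite -opprD normrN; exact: gZ.
by rewrite muN nuN oppeK addeC.
Qed.

(** Connects the distance, which integrates over [Z], with expected costs, which integrate over the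
    whole space. *)
Lemma integral_full (Q : probability (borelRV R m) R) Z g : closed Z ->
  Q Z = 1 ->
  Q.-integrable [set: borelRV R m] (EFin \o g) ->
  \int[Q]_q (g q)%:E = \int[Q]_(q in Z) (g q)%:E.
Proof.
move=> Zc QZ ig; have mZ := measurable_closed_borelRV Zc.
rewrite (@negligible_integral _ _ _ _ _ (~` (Z : set (borelRV R m))))//.
- by rewrite setTD setCK.
- exact: measurableC.
- by have := probability_setC Q mZ; rewrite QZ subee.
Qed.

End Wasserstein.

(** * The Lipschitz majorant of the cost *)

Section Steepness.
Context {R : realType} {m : nat}.
Local Open Scope ereal_scope.

(** Positive and negative parts are compared separately, so the smaller integral may be [-oo], as
    can happen for the cost under some [Q] of the ball. *)
Lemma le_integral_measurable (mu : {measure set (borelRV R m) -> \bar R})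
    (g1 g2 : borelRV R m -> \bar R) :
  measurable_fun setT g1 -> measurable_fun setT g2 ->
    (forall q, g1 q <= g2 q) ->
  \int[mu]_q g1 q <= \int[mu]_q g2 q.
Proof.
move=> mg1 mg2 g12; rewrite integralE [leRHS]integralE leeB//.
- apply: ge0_le_integral => //;
  [exact: measurable_funepos|exact: measurable_funepos|].
  by move=> q _; apply: (@funepos_le _ _ setT) => [q' _|]; rewrite ?in_setT.
- apply: ge0_le_integral => //;
  [exact: measurable_funeneg|exact: measurable_funeneg|].
  by move=> q _; apply: (@funeneg_le _ _ setT) => [q' _|]; rewrite ?in_setT.
Qed.

(** The majorant controls the positive part; an infinite negative part would then make the integral
    [-oo]. *)
Lemma integrable_fin_integral (mu : {measure set (borelRV R m) -> \bar R})
    (g1 g2 : borelRV R m -> \bar R) :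
  measurable_fun setT g1 -> mu.-integrable setT g2 ->
    (forall q, g1 q <= g2 q) ->
  \int[mu]_q g1 q \is a fin_num -> mu.-integrable setT g1.
Proof.
move=> mg1 ig2 g12 fg1; apply/integrableP; split => //.
have mg2 := measurable_int _ ig2.
have pos_fin : \int[mu]_q g1^\+ q < +oo.
  apply: le_lt_trans (integral_funepos_lt_pinfty measurableT ig2).
  apply: ge0_le_integral => //;
    [exact: measurable_funepos|exact: measurable_funepos|].
  by move=> q _; apply: (@funepos_le _ _ setT) => [q' _|]; rewrite ?in_setT.
have neg_fin : \int[mu]_q g1^\- q < +oo.
  rewrite ltey; apply/eqP => neg_oo; move: fg1; rewrite integralE neg_oo.
  have : \int[mu]_q g1^\+ q \is a fin_num by rewrite ge0_fin_numE//
    integral_ge0.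
  by case: (\int[mu]_q g1^\+ q).
rewrite -[fun x => _]/(abse \o g1) fune_abse ge0_integralD//.
- by rewrite lte_add_pinfty.
- exact: measurable_funepos.
- exact: measurable_funeneg.
Qed.

Variables (d : nat) (f : 'rV[R]_d -> 'rV[R]_m -> R).
Variables (P : probability (borelRV R m) R) (Z : set 'rV[R]_m).
Hypotheses (Z_closed : closed Z) (PZ : P Z = 1).
Hypothesis P_moment : \int[P]_q (norm1 q)%:E < +oo.
Hypothesis f_diff : forall x (q y : 'rV[R]_m), differentiable (hfun f x q) y.
Hypothesis f_concave :
  forall x q, convex_function [set: 'rV[R]_m] (- hfun f x q)%R.

(** Tangent bound for [hfun f x q] at 0, evaluated at [q - q']; the slope [G] is the 1-norm of the
    gradient. *)
Lemma concave_le_cone x q : exists2 G : R, (0 <= G)%R &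
  forall q', (f x q' <= f x q + G * norm1 (q - q'))%R.
Proof.
exists (\sum_(j < m) `|hpartial f x q 0 j|)%R; first exact: sumr_ge0.
move=> q'; have := concave_le_tangent (q - q') (f_diff x q 0%R) (f_concave x q).
rewrite /hfun subr0 opprB addrCA subrr addr0 subr0 => /le_trans; apply.
rewrite lerD2l /norm1 mulr_suml; apply: ler_sum => j _.
rewrite (le_trans (ler_norm _))// normrM ler_wpM2l//.
by rewrite (bigD1 j)//= lerDl sumr_ge0.
Qed.

Lemma cost_continuous x : continuous (f x).
Proof.
move=> q; have -> : f x = hfun f x 0%R \o (@GRing.opp _).
  by apply/funext => q' /=; rewrite /hfun sub0r opprK.
apply: continuous_comp; first exact: opp_continuous.
by apply: differentiable_continuous; exact: f_diff.
Qed.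

Lemma cost_measurable x : measurable_fun [set: borelRV R m] (EFin \o (f x :
  borelRV R m -> R)).
Proof.
by apply/measurable_EFinP; apply: continuous_measurable_borelRV;
  exact: cost_continuous.
Qed.

(* The sup-convolutions of f x decrease to f x, with equality at q as soon as
   the Lipschitz constant exceeds the gradient at q. *)
Lemma lipschitz1_upper_approx x (b : \bar R) :
  expected_cost f P x \is a fin_num -> expected_cost f P x < b ->
  exists (K : R) (g : 'rV[R]_m -> R), [/\ (0 < K)%R, lipschitz1 K g,
    forall q, (f x q <= g q)%R & \int[P]_q (g q)%:E < b].
Proof.
move=> fin lb.
have [G0 G00 hG0] := concave_le_cone x 0%R.
(* The slope [G0] at the origin makes every sup-convolution finite; the added [k.+1] makes [K k]
   positive and unbounded. *)
pose K (k : nat) : R := (G0 + k.+1%:R)%R.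
have K0 k : (0 < K k)%R by rewrite ltr_wpDl.
pose g k := sup_convolution (K k) setT (f x).
have bounded k : exists q0 C, forall q, setT q ->
  (f x q - K k * norm1 (q0 - q) <= C)%R.
  exists 0%R, (f x 0%R) => q _; rewrite lerBlDr (le_trans (hG0 q))// lerD2l.
  by rewrite ler_wpM2r ?norm1_ge0// lerDl.
have T0 : [set: 'rV[R]_m] !=set0 by exists 0%R.
have gL k : lipschitz1 (K k) (g k).
  by apply: sup_convolution_lipschitz => //; exact: ltW.
have fg k q : (f x q <= g k q)%R.
  by apply: le_sup_convolution => //; exact: ltW.
have gd k q : (g k q <= g 0%N q)%R.
  apply: sup_convolution_le => //; first exact: ltW.
  move=> q' _; apply: le_trans (sup_convolution_ge (ltW (K0 0%N)) T0 (bounded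
    0%N) q (q' := q') _) => //.
  by rewrite lerD2l lerN2 ler_wpM2r ?norm1_ge0// lerD2l ler_nat.
have gE q : exists k0, forall k, (k0 <= k)%N -> g k q = f x q.
  have [G _ hG] := concave_le_cone x q.
  exists (Num.truncn G) => k Gk; apply: sup_convolution_id => //;
    first exact: ltW.
  move=> q' _; rewrite (le_trans (hG q'))// lerD2l ler_wpM2r ?norm1_ge0//.
  rewrite /K (le_trans (ltW (truncnS_gt G)))// ler_wpDl// ler_nat ltnS//.
have mf := cost_measurable x.
have Pm := finite_first_moment_probability P_moment.
have ig k : P.-integrable [set: borelRV R m] (EFin \o g k).
  by apply: lipschitz1_integrable Pm _ (gL k); exact: ltW.
have iff : P.-integrable [set: borelRV R m] (EFin \o f x).
  by apply: integrable_fin_integral mf (ig 0%N) _ fin => q; rewrite lee_fin.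
(* Since [f x <= g k <= g 0], the function [|g 0| + |f x|] dominates. *)
have [] := @dominated_convergence _ _ _ P setT measurableT (fun k => EFin \o g
  k)
  (EFin \o f x) (fun q => `|(g 0%N q)%:E| + `|(f x q)%:E|).
- by move=> k; exact: (measurable_int _ (ig k)).
- exact: mf.
- apply: aeW => q _; have [k0 hk0] := gE q.
  apply: cvg_near_cst; exists k0 => // k /= k0k; by rewrite hk0.
- by apply: integrableD => //;
  [exact: (integrable_abse (ig 0%N))|exact: (integrable_abse iff)].
- apply: aeW => q k _; rewrite /= -EFinD lee_fin.
  have := fg k q; have := gd k q; rewrite ler_norml => h1 h2; apply/andP; split.
    by have := ler_norm (- f x q)%R; have := normr_ge0 (g 0%N q);
      rewrite normrN; lra.
  by have := ler_norm (g 0%N q); have := normr_ge0 (f x q); lra.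
move=> _ _ /= cv.
suff [k hk] : exists k, \int[P]_q (g k q)%:E < b by exists (K k), (g k); split.
apply/not_existsP => hk; move: lb; rewrite ltNge => /negP; apply.
rewrite /expected_cost -(cvg_lim _ cv)//; apply: lime_ge.
  by apply/cvg_ex; eexists; exact: cv.
by apply: nearW => k; rewrite leNgt; apply/negP/hk.
Qed.

(** Passing from [Q] to [nu], then from [nu] to [P], changes the mean of the majorant by at most
    [K * r] each time. [x] and [K] are fixed before [nu], [Q] and [r], so they serve all samples and
    periods. *)
Lemma certificate_center_bound (eps : R) : (0 < eps)%R ->
  optimal_cost f P \is a fin_num ->
  exists (x : 'rV[R]_d) (K : R), (0 < K)%R /\
    forall (nu : {measure set (borelRV R m) ->
      \bar R}) (Q : probability (borelRV R m) R) (r : R),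
    finite_first_moment nu -> finite_moment_on Z Q ->
    wasserstein Z P nu <= r%:E -> wasserstein Z nu Q <= r%:E ->
    expected_cost f Q x <= optimal_cost f P + (eps + 2 * K * r)%:E.
Proof.
move=> eps0 Jfin.
have [_ [x _ <-] xlt] := lb_ereal_inf_adherent eps0 Jfin.
have xfin : expected_cost f P x \is a fin_num.
  apply/fin_numPlt; apply/andP; split; last first.
    by rewrite (lt_le_trans xlt)// leey.
  apply: (@lt_le_trans _ _ (optimal_cost f P)).
    by case/fin_numPlt/andP: Jfin.
  by apply: ereal_inf_lbound; exists x.
have [K [g [K0 gL fg gint]]] := lipschitz1_upper_approx xfin xlt.
exists x, K; split => // nu Q r nuf [QZ Qm] W1 W2.
have Pm := finite_first_moment_probability P_moment.
have Qm' := finite_first_moment_probability Qm.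
have igP := lipschitz1_integrable Pm (ltW K0) gL.
have igQ := lipschitz1_integrable Qm' (ltW K0) gL.
have Z0 : Z !=set0.
  apply/set0P/negP => /eqP Z0; move: PZ; rewrite Z0 measure0 => /eqP.
  by rewrite eq_sym onee_eq0.
have W1' := le_trans (wasserstein_sym Z_closed Z0 nuf Pm) W1.
have W2' := le_trans (wasserstein_sym Z_closed Z0 Qm' nuf) W2.
apply: (@le_trans _ _ (\int[Q]_q (g q)%:E)).
  apply: le_integral_measurable;
    [exact: cost_measurable|exact: measurable_int igQ|].
  by move=> q; rewrite lee_fin.
rewrite (integral_full Z_closed QZ igQ).
rewrite (le_trans (wasserstein_lipschitz Z_closed Qm' nuf W2' K0 gL))//.
rewrite (le_trans (leeD2r _ (wasserstein_lipschitz Z_closed nuf Pm W1' K0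
  gL)))//.
rewrite -(integral_full Z_closed PZ igP) -addeA -EFinD.
have -> : (eps + 2 * K * r)%:E = eps%:E + (K * r + K * r)%:E.
  by rewrite -EFinD; congr EFin; lra.
by rewrite addeA leeD2r// ltW.
Qed.

End Steepness.

(** * Deviation events and Borel-Cantelli *)

Section Events.
Context {R : realType} {dO : measure_display} {Omega : measurableType dO}.
Variable Pr : probability Omega R.
Local Open Scope ereal_scope.

Lemma probability_bigcap1 (A : nat -> set Omega) :
  (forall k, measurable (A k)) -> (forall k, Pr (A k) = 1) ->
    Pr (\bigcap_k A k) = 1.
Proof.
move=> mA A1; have mI : measurable (\bigcap_k A k) by exact: bigcapT_measurable.
have mC k : measurable (~` A k) by exact: measurableC.
have C0 k : Pr (~` A k) = 0 by rewrite probability_setC// A1 subee.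
have I0 : Pr (~` \bigcap_k A k) = 0.
  have : Pr.-negligible (\bigcup_k ~` A k).
    by apply: negligible_bigcup => k; exists (~` A k); split;
      [exact: mC|exact: C0|].
  rewrite -setC_bigcap => -[N [mN N0 sN]].
  by apply/eqP; rewrite -measure_le0 -N0 le_measure ?inE//; exact: measurableC.
have := probability_setC Pr (measurableC mI).
by rewrite setCK I0 sube0.
Qed.

Lemma probability_setDC (A B : set Omega) (b : R) : measurable A ->
  measurable B ->
  Pr A = 1 -> Pr B <= b%:E -> (1 - b)%:E <= Pr (A `\` B).
Proof.
move=> mA mB A1 Bb; have mBC := measurableC mB.
have : Pr (~` (A `\` B)) <= b%:E.
  have h : Pr (~` A `|` B) <= Pr (~` A) + Pr B by apply: measureU2 => //;
    exact: measurableC.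
  rewrite setDE setCI setCK (le_trans h)//.
  by rewrite probability_setC// A1 subee// add0e.
rewrite probability_setC; last exact: measurableD.
have : Pr (A `\` B) \is a fin_num by apply: fin_num_measure; exact: measurableD.
case: (Pr (A `\` B)) => [p| |]//= _; rewrite -EFinB !lee_fin; lra.
Qed.

(* The random index n0 is the first one from N0 on after which the events do
   not occur, if it exists: by Borel-Cantelli it does almost surely. *)
Lemma borel_cantelli_index (B : nat -> set Omega) (N0 : nat) :
  (forall k, measurable (B k)) -> \sum_(k <oo) Pr (B k) < +oo ->
  exists (n0 : Omega -> nat) (G : set Omega),
    [/\ measurable_fun setT n0, forall w, (N0 <=
      n0 w)%N, measurable G, Pr G = 1 &
        forall w, G w -> forall k, (n0 w <= k)%N -> ~ B k w].
Proof.
move=> mB Bfin.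
pose F n := \bigcup_(k >= n) B k.
have mF n : measurable (F n) by apply: bigcup_measurable.
have mL : measurable (lim_sup_set B) by exact: bigcapT_measurable.
have L0 : Pr (lim_sup_set B) = 0 by exact: lim_sup_set_cvg0.
pose p w n := (N0 <= n)%N && `[< ~ F n w >].
pose n0 w := if pselect (exists n, p w n) is left h then ex_minn h else N0.
have mp n : measurable [set w | p w n].
  rewrite /p; case: (leqP N0 n) => N0n /=; last first.
    by rewrite (_ : [set w | _] = set0)//; apply/seteqP; split.
  rewrite (_ : [set w | _] = ~` F n); first exact: measurableC.
  by apply/seteqP; split => w /= /asboolP.
(* Measurability through level sets: [n] is the first admissible index, or none exists and [n] is
   the default [N0]. *)
have n0E n : n0 @^-1` [set n] =
    ([set w | p w n] `&` \bigcap_(k < n) ~` [set w | p w k]) `|`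
    (if n == N0 then ~` \bigcup_k [set w | p w k] else set0).
  apply/seteqP; split => w /=.
    rewrite /n0; case: pselect => [h|h] nE.
      case: ex_minnP nE => k pk kmin <-; left; split => // j /= jk pj.
      by have := kmin _ pj; rewrite leqNgt jk.
    by right; rewrite -nE eqxx => -[k _ pk]; apply: h; exists k.
  case=> [[pn pmin]|].
    rewrite /n0; case: pselect => [h|[]]; last by exists n.
    case: ex_minnP => k pk kmin; apply/eqP; rewrite eqn_leq kmin// leqNgt.
    by apply/negP => kn; exact: pmin pk.
  case: eqP => // -> np; rewrite /n0; case: pselect => // -[k pk].
  by exfalso; apply: np; exists k.
exists n0, (~` lim_sup_set B); split.
- move=> _ A _; rewrite setTI (_ : n0 @^-1` A = \bigcup_(n in A) n0 @^-1` [set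
  n]); last first.
    apply/seteqP; split => [w Aw|w [n An]]; first by exists (n0 w).
    by rewrite /preimage/= => ->.
  apply: bigcup_measurable => n _; rewrite n0E; apply: measurableU.
    apply: measurableI => //; rewrite bigcap_mkcond.
    apply: bigcapT_measurable => k; case: ifP => // _; exact: measurableC.
  by case: ifP => // _; apply: measurableC; exact: bigcupT_measurable.
- by move=> w; rewrite /n0; case: pselect => // h; case: ex_minnP => k /andP[].
- exact: measurableC.
- by rewrite probability_setC// L0 sube0.
- move=> w nL; have h : exists n, p w n.
    move/existsNP : nL => [n /not_implyP[_ nF]].
    exists (maxn n N0); rewrite /p leq_maxr/=; apply/asboolP => -[k /= nk Bk].
    by apply: nF; exists k => //=; rewrite (leq_trans _ nk)// leq_maxl.
  move=> k; rewrite /n0; case: pselect => // h'.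
  case: ex_minnP => j /andP[_ /asboolP nF] _ jk Bk; apply: nF; by exists k.
Qed.

Lemma sum_EFin_lty (u : nat -> R) : (forall n,
  (0 <= u n)%R) -> cvgn (series u) ->
  \sum_(k <oo) (u k)%:E < +oo.
Proof.
move=> u0 cu.
have -> : \sum_(k <oo) (u k)%:E = limn (EFin \o series u).
  by apply: congr_lim; apply/funext => n /=; rewrite /series/= sumEFin.
by rewrite EFin_lim// ltry.
Qed.

End Events.

(** * Concentration at the Wasserstein radius *)

Section Deviation.
Context {R : realType} {m : nat}.
Variables (a c1 c2 : R) (beta : nat -> R).
Hypotheses (a_gt1 : 1 < a) (c1_gt0 : 0 < c1) (c2_gt0 : 0 < c2).
Local Notation rho := (wass_radius m a c1 c2 beta).

Lemma wass_radius_ge0 n : 0 <= rho n.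
Proof. by rewrite /wass_radius; case: ifP => _; exact: powR_ge0. Qed.

Lemma conc_bound_le n e : 0 < e -> conc_bound m a c1 c2 n e <= c1.
Proof.
move=> e0; rewrite /conc_bound; case: ifP => _;
  rewrite ger_pMr// -expR0 ler_expR oppr_le0.
  by rewrite !mulr_ge0// ?exprn_ge0// ltW.
by rewrite !mulr_ge0// ?powR_ge0// ltW.
Qed.

(** The radius inverts the concentration bound; the branches agree because [l / c2 <= n%:R] exactly
    when the radius is at most 1. *)
Lemma conc_bound_radius n : (0 < n)%N -> 0 < beta n -> beta n < c1 ->
  0 < rho n /\ conc_bound m a c1 c2 n (rho n) = beta n.
Proof.
move=> n0 b0 bc; have n0' : 0 < n%:R :> R by rewrite ltr0n.
set l := ln (c1 / beta n).
have l0 : 0 < l by rewrite ln_gt0// ltr_pdivlMr// mul1r.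
have cn0 : 0 < c2 * n%:R by rewrite mulr_gt0.
have ln0 : 0 < l / (c2 * n%:R) by rewrite divr_gt0.
have expl : c1 * expR (- l) = beta n.
  by rewrite expRN lnK ?posrE ?divr_gt0// invf_div mulrC divfK// gt_eqF.
have lE : c2 * n%:R * (l / (c2 * n%:R)) = l by rewrite mulrC divfK// gt_eqF.
have p1 p : 1 `^ p = 1 :> R by rewrite powR1.
rewrite /wass_radius -/l; case: ifP => ln; split; rewrite ?powR_gt0//;
  rewrite /conc_bound.
- have ln1 : l / (c2 * n%:R) <= 1.
    by rewrite ler_pdivrMr// mul1r mulrC -ler_pdivrMr.
  rewrite ifT; last first.
    rewrite -[leRHS](p1 ((maxn 2 m)%:R^-1)); apply: ge0_ler_powR ln1;
      rewrite ?nnegrE ?invr_ge0//.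
    exact: ltW.
  rewrite -powR_mulrn ?powR_ge0// -powRrM mulVf; last first.
    by rewrite pnatr_eq0 -lt0n leq_max.
  by rewrite powRr1 ?ltW// lE.
- have ln1 : 1 < l / (c2 * n%:R).
    by rewrite ltr_pdivlMr// mul1r mulrC -ltr_pdivlMr// ltNge ln.
  have a0 : 0 < a by rewrite (lt_trans ltr01).
  rewrite ifF; last first.
    apply/negbTE; rewrite -ltNge -[ltLHS](p1 a^-1); apply: gt0_ltr_powR ln1;
      rewrite ?nnegrE ?invr_gt0//.
    exact: ltW.
  by rewrite -powRrM mulVf ?gt_eqF// powRr1 ?ltW// lE.
Qed.

Context {dO : measure_display} {Omega : measurableType dO} (Pr : probability
  Omega R).

Lemma deviation_event (W : nat -> Omega -> \bar R) :
  (forall n e, (0 < n)%N -> 0 < e ->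
    prob_le Pr [set w | (e%:E <= W n w)%E] (conc_bound m a c1 c2 n e)) ->
  (forall n, (0 < n)%N -> 0 < beta n) ->
  forall n, (0 < n)%N -> exists B : set Omega, [/\ measurable B,
    (Pr B <= (beta n)%:E)%E & forall w, ~ B w -> (W n w <= (rho n)%:E)%E].
Proof.
move=> conc beta0 n n0; have [c1b|bc1] := leP c1 (beta n); last first.
  have [r0 rE] := conc_bound_radius n0 (beta0 n n0) bc1.
  have [B [mB sB PB]] := conc n _ n0 r0; exists B; split => //;
    first by rewrite -rE.
  by move=> w nB; rewrite leNgt; apply/negP => /ltW /sB.
(* here the radius may be 0, but W n w > 0 has probability at most c1 *)
have e0 k : 0 < k.+1%:R^-1 :> R by rewrite invr_gt0.
have /choice[B hB] : forall k, exists B : set Omega, [/\ measurable B,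
    [set w | (k.+1%:R^-1%:E <= W n w)%E] `<=` B &
    (Pr B <= (conc_bound m a c1 c2 n k.+1%:R^-1)%:E)%E].
  by move=> k; exact: conc.
have mB k : measurable (B k) by case: (hB k).
(* These sets increase and [F i] lies in [B i], so continuity from below bounds their union by
   [c1 <= beta n]. If [W n w > 0], then [w] is in [B k] for all large [k], hence in some [F i]. *)
pose F i := \bigcap_(k >= i) B k.
have mF i : measurable (F i) by apply: bigcap_measurable => //; exists i => /=.
have PF i : (Pr (F i) <= (beta n)%:E)%E.
  have [_ _ PB] := hB i.
  apply: (le_trans (le_measure _ _ _ (_ : F i `<=` B i))); rewrite ?inE//.
    by move=> w; apply => /=.
  by rewrite (le_trans PB)// lee_fin (le_trans (conc_bound_le _ (e0 i))).
exists (\bigcup_i F i); split.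
- exact: bigcupT_measurable.
- have cv : Pr (F i) @[i --> \oo] --> Pr (\bigcup_i F i).
    apply: nondecreasing_cvg_mu => //; first exact: bigcupT_measurable.
    move=> i j ij; apply/subsetPset => w Fw k /= jk; apply: Fw => /=.
    exact: leq_trans jk.
  rewrite -(cvg_lim _ cv)//; apply: lime_le; first by apply/cvg_ex; eexists;
    exact: cv.
  exact: nearW.
- move=> w nF; apply: (@le_trans _ _ 0%E);
  last by rewrite lee_fin wass_radius_ge0.
  rewrite leNgt; apply/negP => W0; apply: nF.
  have [i iW] : exists i, (i.+1%:R^-1%:E <= W n w)%E.
    move: W0; case: (W n w) => [r| |]//=; last by exists 0%N; rewrite leey.
    rewrite lte_fin => r0; exists (Num.truncn r^-1); rewrite lee_fin.
    by rewrite invf_ple ?posrE// ltW// truncnS_gt.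
  exists i => // k /= ik; have [_ sB _] := hB k; apply: sB => /=.
  rewrite (le_trans _ iW)// lee_fin lef_pV2 ?posrE ?ltr0n// ler_nat ltnS//.
Qed.

End Deviation.

(** * The guarantees *)

Lemma norm1_le_expR (R : realType) (m : nat) (a : R) (q : 'rV[R]_m) : 1 < a ->
  norm1 q <= expR (norm1 q `^ a).
Proof.
move=> a1; have [q1|q1] := leP 1 (norm1 q); last first.
  by rewrite (le_trans (ltW q1))// -expR0 ler_expR powR_ge0.
have h : norm1 q <= norm1 q `^ a.
  by rewrite -[leLHS]powRr1 ?norm1_ge0// ler_powR// ltW.
by rewrite (le_trans h)// (le_trans _ (expR_ge1Dx _))// lerDr.
Qed.

Lemma light_tail_moment (R : realType) (m : nat) (a : R)
    (P : probability (borelRV R m) R) : 1 < a ->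
  (\int[P]_q (expR (norm1 q `^ a))%:E < +oo ->
   \int[P]_q (norm1 q)%:E < +oo)%E.
Proof.
move=> a1; apply: le_lt_trans; apply: ge0_le_integral => //.
- by move=> q _; rewrite lee_fin norm1_ge0.
- by apply/measurable_EFinP; exact: measurable_norm1.
- apply/measurable_EFinP; apply: measurableT_comp => //.
  apply: (measurableT_comp (measurable_powR a)); exact: measurable_norm1.
- by move=> q _; rewrite lee_fin norm1_le_expR.
Qed.

Theorem mainTheorem1 (R : realType) (d m : nat)
  (* the random variable and its samples; X k is the (k+1)-st sample *)
  (dO : measure_display) (Omega : measurableType dO) (Pr : probability Omega R)
  (xi : {RV Pr >-> borelRV R m}) (Z : set 'rV[R]_m)
  (m_gt0 : (0 < m)%N) (m_neq2 : m <> 2%N)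
  (Z_support : is_support (distribution Pr xi) Z)
  (* (i) *)
  (a : R) (a_gt1 : 1 < a)
  (light_tail : (\int[distribution Pr xi]_q (expR (norm1 q `^ a))%:E < +oo)%E)
  (* the cost; (ii), except for the curvature constants, and (iv) *)
  (f : 'rV[R]_d -> 'rV[R]_m -> R)
  (f_diff : forall x (q y : 'rV[R]_m), differentiable (hfun f x q) y)
  (f_concave : forall x q, convex_function [set: 'rV[R]_m] (- hfun f x q))
  (f_convex : forall q, convex_function [set: 'rV[R]_d] (f ^~ q))
  (Jstar_fin : optimal_cost f (distribution Pr xi) \is a fin_num)
  (eps1 : R) (eps1_gt0 : 0 < eps1) :
  let P : probability (borelRV R m) R := distribution Pr xi in
  let Jstar := optimal_cost f P in
  exists2 Lhat : R, 0 < Lhat &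
  forall
    (X : nat -> {RV Pr >-> borelRV R m})
    (X_indep : mutually_independent X)
    (X_law : forall k A, measurable A -> distribution Pr (X k) A = P A)
    (* concentration, confidence levels *)
    (c1 c2 : R) (c1_gt0 : 0 < c1) (c2_gt0 : 0 < c2)
    (concentration : forall (n : nat) (e : R), (0 < n)%N -> 0 < e ->
      prob_le Pr [set w | (e%:E <= wasserstein Z P (empirical n (X ^~ w)))%E]
        (conc_bound m a c1 c2 n e))
    (beta : nat -> R)
    (beta01 : forall n, (0 < n)%N -> 0 < beta n < 1)
    (beta_decr : forall n, (0 < n)%N -> beta n.+1 < beta n),
  let rho := wass_radius m a c1 c2 beta in
  forall
    (certificate_P1 : forall n z x, (0 < n)%N -> (forall k, Z (z k)) ->
      certificate f Z (rho n) n z x = P1_value f n (rho n) z x)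
    (* (v) *)
    (xstar : nat -> (nat -> 'rV[R]_m) -> 'rV[R]_d)
    (xstar_min : forall n z, (0 < n)%N -> (forall k, Z (z k)) -> forall x,
      (certificate f Z (rho n) n z (xstar n z) <=
       certificate f Z (rho n) n z x)%E)
    (sg : 'rV[R]_d -> 'rV[R]_m -> 'rV[R]_d)
    (sg_subgradient : forall x q x',
      f x q + \sum_(j < d) sg x q 0 j * (x' - x) 0 j <= f x' q)
    (L eps2 epsSA : R),
  let mu := Num.max L 1 in
  let tol := eps2 / mu - epsSA in
  forall
    (eps_ord : 0 < eps2 /\ eps1 <= epsSA < eps2 / mu)
    (* period lengths and execution of the algorithm, for each outcome *)
    (T : Omega -> nat -> nat) (o : Omega -> run R d m),
  let data w : nat -> 'rV[R]_m := X ^~ w in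
  let in_supp w := forall k, Z (data w k) in
  let execution N := forall w, in_supp w ->
    [/\ OnDA f sg Z rho eps1 epsSA tol N (T w) (data w) (o w),
        bounded_subgradients sg L N (data w) (o w),
        large_M xstar N (data w) (o w) &
        slow_stream f sg Z rho eps1 epsSA N (T w) (data w) (o w)] in
  let J n w := certificate f Z (rho n) n (data w) in
  let x_ w n := decision (o w) n in
  let Jeps w n := cert_value f (data w) (o w) n in
  (* for a possibly random period n: the period is completed in time and yields
     an eps2-optimal, eps1-proper decision with its certificate *)
  let found (n : Omega -> nat) (p : R) :=
    (forall w, in_supp w ->
      [/\ completed (o w) (n w),
          eps_optimal f Z rho eps2 (n w) (data w) (x_ w (n w)) &
          eps_certified f Z rho eps1 (data w) (x_ w (n w))
            (st_y (run_end (o w) (n w)))]) /\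
    prob_ge Pr [set w | (expected_cost f P (x_ w (n w)) <=
                         J (n w) w (x_ w (n w)))%E] p in
  (* finite horizon *)
  (forall N : nat, curvature_condition f N -> execution N ->
    forall n, (0 < n <= N)%N ->
    [/\ found (fun=> n) (1 - beta n),
        prob_ge Pr [set w | (expected_cost f P (x_ w n) <=
                             (Jeps w n + eps1)%:E)%E] (1 - beta n) &
        prob_ge Pr [set w | ((Jeps w n)%:E <=
          Jstar + (eps1 + eps2 + 2 * Lhat * rho n)%:E)%E] (1 - beta n)]) /\
  (* infinite horizon *)
  ((forall N, (0 < N)%N -> curvature_condition f N) ->
    (forall N, execution N) ->
    cvgn (series beta) -> rho @ \oo --> 0 ->
    forall eps3 : R, 0 < eps3 ->
    exists n0 : Omega -> nat,
    [/\ measurable_fun setT n0 /\ (forall w, (0 < n0 w)%N),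
        forall w, in_supp w -> forall n, (0 < n <= n0 w)%N -> completed (o w) n,
        found n0 1,
        prob_ge Pr [set w | (expected_cost f P (x_ w (n0 w)) <=
                             (Jeps w (n0 w) + eps1)%:E)%E] 1 &
        {ae Pr, forall w,
          (ereal_sup [set (Jeps w n)%:E | n in [set n | (n0 w <= n)%N]] <=
           Jstar + (eps1 + eps2 + eps3)%:E)%E}]).
Proof.
move=> P Jstar; have [Z_closed PZ _] := Z_support.
have P_moment := light_tail_moment a_gt1 light_tail.
(* [x0] is an eps1-optimal decision for the true problem: the [eps1] of the upper bound on [Jeps]
   comes from here. *)
have [x0 [K [K0 x0_bound]]] :=
  certificate_center_bound Z_closed PZ P_moment f_diff f_concave eps1_gt0
    Jstar_fin.
exists K => // X X_indep X_law c1 c2 c1_gt0 c2_gt0 concentration beta beta01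
  beta_decr rho.
move=> certificate_P1 xstar xstar_min sg sg_subgradient L eps2 epsSA mu tol.
move=> [eps2_gt0 /andP[eps1_le epsSA_lt]] T o data in_supp execution J x_ Jeps
  found.
have rho_ge0 n : 0 <= rho n by exact: wass_radius_ge0.
have epsSA_ge0 : 0 <= epsSA by rewrite (le_trans (ltW eps1_gt0)).
have tol_gt0 : 0 < tol by rewrite subr_gt0.
have Z0 : Z !=set0.
  apply/set0P/negP => /eqP Z0; move: PZ; rewrite Z0 measure0 => /eqP.
  by rewrite eq_sym onee_eq0.
have P_ffm := finite_first_moment_probability P_moment.
pose S := \bigcap_k (X k @^-1` Z).
have mXZ k : measurable (X k @^-1` Z).
  by rewrite -[X in measurable X]setTI; apply: measurable_funP => //;
    exact: measurable_closed_borelRV.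
have mS : measurable S by exact: bigcapT_measurable.
have PS : Pr S = 1%E.
  apply: probability_bigcap1 => // k.
  by have := X_law k Z (measurable_closed_borelRV Z_closed); rewrite PZ.
have S_supp w : S w -> in_supp w by move=> Sw k; exact: Sw.
(* Index shift: [B n] is the deviation event of period [n.+1]. *)
have /choice[B hB] : forall n, exists B : set Omega, [/\ measurable B,
    (Pr B <= (beta n.+1)%:E)%E &
    forall w, ~ B w -> (wasserstein Z P (empirical n.+1 (data w)) <=
      (rho n.+1)%:E)%E].
  move=> n; apply: (deviation_event a_gt1 c1_gt0 c2_gt0 concentration) => //.
  by move=> k /beta01 /andP[].
have mB n : measurable (B n) by case: (hB n).
have JE n w x : (0 < n)%N -> in_supp w ->
    J n w x = (Jr f Z n (data w) (rho n) x)%:E.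
  move=> n0 sw; apply: certificate_fin => // x'; exact: certificate_P1.
have cost_le n w x : in_supp w -> ~ B n w -> (expected_cost f P x <=
  J n.+1 w x)%E.
  move=> sw nB; have [_ _ /(_ _ nB) W1] := hB n.
  apply: ereal_sup_ubound; exists P => //; split; first by split.
  apply: le_trans W1; apply: wasserstein_sym => //.
  exact: finite_first_moment_empirical.
have center_le n w : in_supp w -> ~ B n w ->
    (J n.+1 w x0 <= Jstar + (eps1 + 2 * K * rho n.+1)%:E)%E.
  move=> sw nB; have [_ _ /(_ _ nB) W1] := hB n.
  apply: ge_ereal_sup => _ [Q [Qm W2] <-]; apply: x0_bound W1 W2 => //.
  exact: finite_first_moment_empirical.
have period N w n : execution N -> in_supp w -> (0 < n <= N)%N ->
    [/\ completed (o w) n, eps_optimal f Z rho eps2 n (data w) (x_ w n) &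
        eps_certified f Z rho eps1 (data w) (x_ w n) (st_y (run_end (o w) n))].
  move=> ex sw nN; have n0 : (0 < n)%N by case/andP: nN.
  have [/(_ _ nN)[rl pe _] /(_ _ nN) bs /(_ _ nN) lM /(_ _ nN) slow] := ex w sw.
  have P1n x : certificate f Z (rho n) n (data w) x = P1_value f n (rho n)
    (data w) x.
    exact: certificate_P1.
  have xmin x : Jr f Z n (data w) (rho n) (xstar n (data w)) <=
      Jr f Z n (data w) (rho n) x.
    by rewrite -lee_fin -!JE//; exact: xstar_min.
  have M_ge0 := le_trans (norm1_ge0 _) lM.
  have [stop feas cert opt] :=
    period_correct n0 m_gt0 (rho_ge0 n) f_diff f_concave
    P1n eps1_le sg_subgradient epsSA_ge0 tol_gt0 rl M_ge0 (ltW eps2_gt0)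
    lM slow pe bs.
  split => //.
  - move=> x'; rewrite -/(J n w _) -/(J n w x') !JE// -EFinB lee_fin lerBlDl.
    by rewrite (le_trans opt)// lerD2r.
  - by split => //; rewrite -/(J n w _) JE// lee_fin.
have Jeps_ge N w n : execution N -> in_supp w -> (0 < n <= N)%N ->
    (J n w (x_ w n) <= (Jeps w n + eps1)%:E)%E.
  by move=> ex sw nN; have [_ _ []] := period _ _ _ ex sw nN.
have Jeps_le N w n : execution N -> in_supp w -> (0 < n.+1 <= N)%N -> ~ B n w ->
    ((Jeps w n.+1)%:E <= Jstar + (eps1 + eps2 + 2 * K * rho n.+1)%:E)%E.
  move=> ex sw nN nB; have [_ opt [feas _]] := period _ _ _ ex sw nN.
  have h1 : ((Jeps w n.+1)%:E <= J n.+1 w (x_ w n.+1))%E.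
    rewrite JE// lee_fin; apply: objective_le_certificate feas => //.
    by move=> x; exact: certificate_P1.
  have h2 := opt x0; have h3 := center_le n w sw nB; move: h1 h2 h3.
  (* The chain is [Jeps <= J (x_n) <= J x0 + eps2], then [center_le]. *)
  rewrite -/(J n.+1 w _) -/(J n.+1 w x0) !JE//.
  rewrite -[Jstar](fineK Jstar_fin) -EFinB -!EFinD !lee_fin; lra.
split.
- move=> N _ ex n; case: n => [//|n] nN.
  have [_ PB _] := hB n.
  have PG := probability_setDC mS (mB n) PS PB.
  have mG := measurableD mS (mB n).
  split.
  + split; first by move=> w sw; exact: period ex sw nN.
    (* This measurable set, on which samples lie in [Z] and [P] in the ball, witnesses all three
       bounds. *)
    by exists (S `\` B n); split => // w [/S_supp sw nB]; exact: cost_le.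
  + exists (S `\` B n); split => // w [/S_supp sw nB] /=.
    by rewrite (le_trans (cost_le n w _ sw nB))//; exact: Jeps_ge ex sw nN.
  + exists (S `\` B n); split => // w [/S_supp sw nB] /=.
    exact: Jeps_le ex sw nN nB.
- move=> _ ex beta_sum rho0 eps3 eps3_gt0.
  have [N0 hN0] : exists N0, forall n, (N0 <= n)%N -> 2 * K * rho n.+1 <= eps3.
    have K2 : 0 < 2 * K by rewrite mulr_gt0.
    have [N0 _ hN0] := cvgr_le _ rho0 _ (divr_gt0 eps3_gt0 K2).
    exists N0 => n N0n; rewrite mulrC -ler_pdivlMr//; apply: hN0 => /=.
    exact: leqW.
  (* By the index shift the sum starts at [beta 1]; [beta 0] is subtracted as a constant. *)
  have Bsum : (\sum_(k <oo) Pr (B k) < +oo)%E.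
    apply: (@le_lt_trans _ _ (\sum_(k <oo) (beta k.+1)%:E)%E).
      by apply: lee_nneseries => // k _; case: (hB k).
    apply: sum_EFin_lty => [n|]; first by have /andP[/ltW] := beta01 n.+1 isT.
    have -> : series (fun n => beta n.+1) = (fun n => series beta n.+1 - beta
      0%N).
      apply/funext => n; rewrite /series/= big_nat_recl//= addrAC subrr add0r.
      by [].
    apply: is_cvgB; last exact: is_cvg_cst.
    by apply/cvg_ex; exists (limn (series beta));
      rewrite (cvg_shiftS (series beta)).
  have [n0 [G [mn0 N0n0 mG PG hG]]] := borel_cantelli_index N0 mB Bsum.
  have PSG : (1%:E <= Pr (S `&` G))%E.
    have PGC : (Pr (~` G) <= 0%:E)%E by rewrite probability_setC// PG subee.
    have := probability_setDC mS (measurableC mG) PS PGC.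
    by rewrite setDE setCK subr0.
  have mSG : measurable (S `&` G) by exact: measurableI.
  (* The successor undoes the shift: on [G], no deviation occurs in any period from [(n0 w).+1]
     on. *)
  exists (fun w => (n0 w).+1); split.
  + by split => // mT A _; exact: (mn0 mT (succn @^-1` A) Logic.I).
  + move=> w sw n /andP[n_gt0 nn0].
    by have [] := period n w n (ex n) sw; rewrite ?n_gt0/=.
  + split; first by move=> w sw; apply: (period (n0 w).+1) => //=.
    exists (S `&` G); split => // w [/S_supp sw Gw] /=.
    by apply: cost_le => //; exact: hG.
  + exists (S `&` G); split => // w [/S_supp sw Gw] /=.
    apply: (le_trans (cost_le (n0 w) w _ sw (hG _ Gw _ (leqnn _)))).
    by apply: (Jeps_ge (n0 w).+1) => //=.
  + exists (~` (S `&` G)); split.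
    * exact: measurableC.
    * have : (Pr (~` (S `&` G)) <= 0)%E.
        by rewrite probability_setC// (le_trans (leeB (lexx 1%E) PSG))// subee.
      by rewrite measure_le0 => /eqP.
    * apply: subsetC => w [/S_supp sw Gw];
      apply: ge_ereal_sup => _ [n /= n0n <-].
      case: n n0n => [//|n] n0n.
      apply: (le_trans (Jeps_le n.+1 w n (ex n.+1) sw _ (hG _ Gw _ n0n))) =>
        //=.
      by rewrite leeD2l// lee_fin lerD2l hN0// (leq_trans (N0n0 w)).
Qed.
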